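(* A regular topological flow with the small flow boundary property admits a zero-dimensional strongly isomorphic extension.
   Context: A topological flow $(X,\Phi=(\phi_t)_{t\in\mathbb R})$ is a continuous flow on a compact metric space; it is regular if no point is fixed by all $\phi_t$. For $E\subset X$ and an interval $I$, $\phi_I(E)=\{\phi_t(x):x\in E,t\in I\}$. A null set is a set of measure zero for every $\Phi$-invariant Borel probability measure; a full set is a Borel set whose complement is null. A cross-section of time $\eta>0$ is a set $S\subset X$ such that $(x,t)\mapsto\phi_t(x)$ is one-to-one on $S\times[-\eta,\eta]$. It is a weakly extendable cross-section (w.e.c.) of time $\eta$ if its closure $\overline S$ is also a cross-section of time $\eta$. For $0<\zeta\le\eta$ put $S_\zeta=\phi_{[-\zeta,\zeta]}(S)$. For a w.e.c. $S$ the flow interior is $\mathrm{Int}^\Phi(S)=\mathrm{Int}(S_\zeta)\cap S$ (independent of $0<\zeta\le\eta$) and the flow boundary is $\partial^\Phi S=\overline S\setminus\mathrm{Int}^\Phi(S)$. $S$ has a small flow boundary if $\phi_{[-\eta,\eta]}(\partial^\Phi S)$ is a null set. The flow has the small flow boundary property if for every $x\in X$ and every w.e.c. $S'$ with $x\in\mathrm{Int}^\Phi(S')$ there is $S\subset S'$ with $x\in\mathrm{Int}^\Phi(S)$ such that the w.e.c. $S$ has a small flow boundary. For a homeomorphism $T$ of a compact metrizable space $Y$ and a continuous $r:Y\to(0,\infty)$, the suspension flow $(Y_r,\Phi_r)$ is the flow induced by $(y,s)\mapsto(y,s+t)$ on $Y_r=\{(y,s):0\le s\le r(y)\}/\big((y,r(y))\sim(Ty,0)\big)$.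 A topological extension of a flow is a continuous surjective equivariant map $\pi$ from a topological flow onto it. It is a zero-dimensional extension if the extending flow is a suspension flow over a zero-dimensional discrete system $(Y,T)$ with a positive continuous roof function. It is strongly isomorphic if there is a full set $E$ of $X$ such that the restriction of $\pi$ to $\pi^{-1}E$ is one-to-one. *)

(* Defs.v *)
From HB Require Import structures.
From mathcomp Require Import all_boot all_order all_algebra generic_quotient lra.
From mathcomp Require Import all_classical all_reals all_analysis.
From Stdlib Require Import Relation_Operators.

Set Implicit Arguments.
Unset Strict Implicit.
Unset Printing Implicit Defensive.

Import Order.TTheory GRing.Theory Num.Theory.
Import numFieldNormedType.Exports.

Local Open Scope classical_set_scope.
Local Open Scope ring_scope.

Section flows.
Context {R : realType} {X : topologicalType}.
Implicit Types (phi : R -> X -> X) (S : set X) (eta zeta : R).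

Definition is_flow phi :=
  [/\ forall x, phi 0 x = x,
      forall s t x, phi (s + t) x = phi s (phi t x)
    & continuous (fun p : R * X => phi p.1 p.2)].

Definition regular_flow phi := forall x, exists t, phi t x <> x.

Definition flow_image phi (I : set R) (E : set X) : set X :=
  [set phi t x | t in I & x in E].

Definition cross_section phi eta S :=
  0 < eta /\ set_inj (S `*` `[- eta, eta]) (fun p => phi p.2 p.1).

Definition weakly_extendable phi eta S :=
  cross_section phi eta S /\ cross_section phi eta (closure S).

(* For a weakly extendable cross-section of time eta this does not depend on
   zeta in ]0, eta]; see [flow_interior_indep]. *)
Definition flow_interior phi zeta S : set X :=
  interior (flow_image phi `[- zeta, zeta] S) `&` S.

Definition flow_boundary phi zeta S : set X :=
  closure S `\` flow_interior phi zeta S.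

End flows.

Lemma flow_interior_indep {R : realType} {X : metricType R} (phi : R -> X -> X)
    (eta zeta : R) (S : set X) :
  compact [set: X] -> is_flow phi -> weakly_extendable phi eta S ->
  0 < zeta <= eta -> flow_interior phi zeta S = flow_interior phi eta S.
Proof.
move=> cX [phi0 _ cphi] [_ [eta0 inj]] /andP[z0 ze].
have cK : compact (closure S) by exact: (@subclosed_compact X _ _ (@closed_closure X S) cX).
pose I := `[- eta, - zeta] `|` `[zeta, eta] : set R.
pose C := flow_image phi I (closure S).
have cC : closed C.
  apply: (compact_closed (@metric_hausdorff R X)).
  have -> : C = (fun p : R * X => phi p.1 p.2) @` (I `*` closure S).
    apply/seteqP; split=> [_ [t It [x Sx <-]]|_ [[t x] [/= It Sx] <-]].
      by exists (t, x).
    by exists t => //; exists x.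
  apply: continuous_compact; first exact: continuous_subspaceT.
  by apply: compact_setX => //; apply: compactU; exact: segment_compact.
apply/seteqP; split=> x [ix Sx]; split => //.
  apply: interiorS ix => _ [t /= + [y Sy <-]]; rewrite in_itv/= => /andP[t1 t2].
  exists t; last by exists y.
  by rewrite /= in_itv/= (le_trans t2 ze) andbT (le_trans _ t1)// lerN2.
have nC : ~ C x.
  move=> [t It [y Sy tyx]].
  have tE : `[- eta, eta]%classic t.
    case: It => /=; rewrite !in_itv/= => /andP[t1 t2]; apply/andP; split => //.
    - by rewrite (le_trans t2)// (le_trans _ (ltW eta0))// oppr_le0 ltW.
    - by rewrite (le_trans _ t1)// (le_trans _ (ltW z0))// oppr_le0 ltW.
  have e0 : `[- eta, eta]%classic (0 : R).
    by rewrite /= in_itv/= oppr_le0 (ltW eta0).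
  have := inj (y, t) (x, 0).
  rewrite !inE /= phi0 => /(_ (conj Sy tE) (conj (subset_closure Sx) e0) tyx)[_ t0].
  case: It => /=; rewrite t0 !in_itv/= => /andP[].
  - by move=> _; rewrite oppr_ge0 leNgt z0.
  - by rewrite leNgt z0.
have oC : nbhs x (~` C) by apply: open_nbhs_nbhs; split=> //; exact: closed_openC.
move: ix => /=; rewrite /interior /= => nx.
apply: filterS (filterI oC nx) => _ [/[swap]] [t tE [y Sy <-]] nCy.
exists t; last by exists y.
move: tE; rewrite /= !in_itv/= => /andP[t1 t2].
apply/andP; split; rewrite leNgt; apply/negP => ht; apply: nCy; exists t;
  try (by exists y; [exact: subset_closure|]).
- by left; rewrite /= in_itv/= t1 ltW.
- by right; rewrite /= in_itv/= t2 ltW.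
Qed.

(* The library's measurable types are pointed while X may be empty.  We let a
   point x0 of X be the distinguished one; measurability does not depend on it,
   and an empty X carries no probability measure. *)
Definition pointed_at {X : Type} (x0 : X) : Type := X.
HB.instance Definition _ (X : choiceType) (x0 : X) :=
  Choice.copy (pointed_at x0) X.
HB.instance Definition _ (X : choiceType) (x0 : X) :=
  isPointed.Build (pointed_at x0) x0.

Definition borel_type {X : topologicalType} (x0 : X) :=
  g_sigma_algebraType (@open X : set (set (pointed_at x0))).

Section null_sets.
Context {R : realType} {X : topologicalType}.
Implicit Types (phi : R -> X -> X) (A E S : set X).

Definition borel_set A := <<s @open X >> A.

Definition invariant_measure phi (x0 : X)
    (mu : probability (borel_type x0) R) :=
  forall t A, borel_set A -> mu (phi t @^-1` A) = mu A.

Definition null_set phi A :=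
  forall (x0 : X) (mu : probability (borel_type x0) R),
    invariant_measure phi mu -> mu.-negligible A.

Definition full_set phi E := borel_set E /\ null_set phi (~` E).

Definition small_flow_boundary phi (eta : R) S :=
  null_set phi (flow_image phi `[- eta, eta] (flow_boundary phi eta S)).

Definition small_flow_boundary_property phi :=
  forall (x : X) (eta : R) S',
    weakly_extendable phi eta S' -> flow_interior phi eta S' x ->
    exists S, [/\ S `<=` S', weakly_extendable phi eta S,
                  flow_interior phi eta S x & small_flow_boundary phi eta S].

End null_sets.

Section suspension.
Local Open Scope quotient_scope.
Context {R : realType} {Y : topologicalType} (T : Y -> Y) (r : Y -> R).

Definition homeomorphism :=
  continuous T /\ exists T' : Y -> Y, [/\ continuous T', cancel T T' & cancel T' T].

Definition under_roof : set (Y * R) := [set p | 0 <= p.2 <= r p.1].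

Definition glue (p q : under_roof) :=
  exists y, val p = (y, r y) /\ val q = (T y, 0).

Definition glue_equiv (p q : under_roof) : bool :=
  `[< clos_refl_sym_trans _ glue p q >].

Lemma glue_equiv_refl : reflexive glue_equiv.
Proof. by move=> p; apply/asboolP; exact: rst_refl. Qed.

Lemma glue_equiv_sym : symmetric glue_equiv.
Proof. by move=> p q; apply/asboolP/asboolP; exact: rst_sym. Qed.

Lemma glue_equiv_trans : transitive glue_equiv.
Proof.
by move=> q p s /asboolP pq /asboolP qs; apply/asboolP; exact: rst_trans pq qs.
Qed.

Canonical glue_equiv_rel :=
  EquivRel glue_equiv glue_equiv_refl glue_equiv_sym glue_equiv_trans.

Definition suspension : topologicalType :=
  quotient_topology {eq_quot glue_equiv_rel}.

Definition suspension_pt (p : under_roof) : suspension :=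
  \pi_{eq_quot glue_equiv_rel} p.

(* These conditions determine Psi on all of R * suspension by the group law,
   see [suspension_flow_unique]. *)
Definition is_suspension_flow (Psi : R -> suspension -> suspension) :=
  is_flow Psi /\
  forall (p q : under_roof) (t : R), val q = ((val p).1, (val p).2 + t) ->
    Psi t (suspension_pt p) = suspension_pt q.

End suspension.

Lemma suspension_flow_unique {R : realType} {Y : topologicalType}
    (T : Y -> Y) (r : Y -> R) (Psi Psi' : R -> suspension T r -> suspension T r) :
  compact [set: Y] -> continuous r -> (forall y, 0 < r y) ->
  is_suspension_flow Psi -> is_suspension_flow Psi' -> Psi = Psi'.
Proof.
move=> cY cr r0 hPsi hPsi'.
have [c c0 cle] : exists2 c : R, 0 < c & forall y, c <= r y.
  have [Y0|/set0P Y0] := eqVneq [set: Y] set0.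
    by exists 1 => // y; have : [set: Y] y by []; rewrite Y0.
  have [m _ hm] := compact_EVT_min Y0 cY (continuous_subspaceT cr).
  by exists (r m) => // y; apply: hm; rewrite inE.
have roof (y : Y) s : 0 <= s <= r y -> (y, s) \in under_roof r.
  by move=> ys; rewrite inE.
have step (z : suspension T r) t : 0 <= t <= c -> exists w,
    forall P : R -> suspension T r -> suspension T r, is_suspension_flow P -> P t z = w.
  move=> /andP[t0 tc].
  have [p ->] : exists p, z = suspension_pt T p.
    by exists (repr z); rewrite /suspension_pt; exact/esym/reprK.
  case: p => -[y s] ys.
  move: (set_mem ys) => /= /andP[/= s0 sr].
  have [str|rst] := leP (s + t) (r y).
    have h : 0 <= s + t <= r y by rewrite str addr_ge0.
    by exists (suspension_pt T (SigSub (roof _ _ h))) => P [_]; exact.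
  have h1 : 0 <= r y <= r y by rewrite lexx ltW.
  have h2 : 0 <= (0 : R) <= r (T y) by rewrite lexx ltW.
  have h3 : 0 <= s + t - r y <= r (T y).
    by have := cle (T y); move=> ?; apply/andP; split; lra.
  exists (suspension_pt T (SigSub (roof _ _ h3))) => P [[_ PD _] hP].
  have tE : t = (s + t - r y) + (r y - s) by lra.
  rewrite [in LHS]tE PD (hP _ (SigSub (roof _ _ h1))); last by rewrite /= addrC subrK.
  have -> : suspension_pt T (SigSub (roof _ _ h1)) =
      suspension_pt T (SigSub (roof _ _ h2)).
    apply/eqmodP/asboolP; apply: rst_step.
    by exists y.
  by apply: hP => /=; rewrite add0r.
have pos z t : 0 <= t -> Psi t z = Psi' t z.
  move=> t0; pose n := (Num.truncn (t / c)).+1; pose u := t / n%:R.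
  have n0 : 0 < n%:R :> R by rewrite ltr0n.
  have u0c : 0 <= u <= c.
    rewrite /u divr_ge0 ?(ltW n0)//= ler_pdivrMr// mulrC -ler_pdivrMr//.
    by rewrite ltW// truncnS_gt.
  have -> : t = u * n%:R by rewrite /u divfK ?gt_eqF.
  elim: (n) => [|k IH].
    by rewrite mulr0; case: hPsi hPsi' => -[-> _ _] _ [[-> _ _] _].
  have -> : u * k.+1%:R = u + u * k%:R by rewrite -natr1 mulrDr mulr1 addrC.
  have [w hw] := step (Psi (u * k%:R) z) u u0c.
  case: (hPsi) (hPsi') => -[_ -> _] _ [[_ -> _] _].
  by rewrite -IH !hw.
apply/funext => t; apply/funext => z; have [t0|t0] := leP 0 t; first exact: pos.
case: (hPsi) (hPsi') => -[P0 PD _] _ [[P'0 P'D _] _].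
have zE : z = Psi' (- t) (Psi t z).
  by rewrite -pos ?oppr_ge0 ?(ltW t0)// -PD addNr P0.
by rewrite [in RHS]zE -P'D subrr P'0.
Qed.

(* On compact metric spaces the library's [zero_dimensional] (clopen sets
   separate points) amounts to having a base of clopen sets. *)
Lemma zero_dimensionalP {R : realType} {Y : metricType R} :
  compact [set: Y] -> zero_dimensional Y <-> basis (@clopen Y).
Proof.
move=> cY; split=> [zY|[_ bY] x y xy].
  split=> [A []//|x].
  have -> : [set U | clopen U /\ U x] = [set D : set Y | D x /\ clopen D].
    by apply/seteqP; split=> U [].
  exact: zero_dimensional_cvg (@metric_hausdorff R Y) zY cY.
have : nbhs x (~` [set y]).
  apply: open_nbhs_nbhs; split; last exact/eqP.
  apply: closed_openC; apply: accessible_closed_set1.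
  exact: hausdorff_accessible (@metric_hausdorff R Y).
by move=> /bY[U /= [cU Ux] Uy]; exists U; split=> // /Uy; apply.
Qed.

Section extensions.
Context {R : realType} {Z X : topologicalType}.

Definition topological_extension
    (Psi : R -> Z -> Z) (phi : R -> X -> X) (pi : Z -> X) :=
  [/\ continuous pi, range pi = setT & forall t z, pi (Psi t z) = phi t (pi z)].

Definition strongly_isomorphic (phi : R -> X -> X) (pi : Z -> X) :=
  exists E, full_set phi E /\ set_inj (pi @^-1` E) pi.

End extensions.

(* Main.v *)
(* A Bebutov-type construction gives a local section through every point, and the
   small flow boundary property shrinks it to one with a null boundary.  Finitely
   many such pieces, slid along the flow by distinct small times to become
   disjoint, form a global section S that every orbit meets with gaps bounded
   below, and bounded above by less than every period.  Cover S, at each scale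
   1/k, by finitely many small subsets C (k, i) with null relative boundary.  A
   point of S is coded by which C (k, i) contain its successive returns to S; the
   closure Y of the set of codes is a shift-invariant subset of a Cantor space,
   and a code determines both the point and its return time, continuously.  This
   makes the suspension of Y by the return time an extension of the flow, one-to-one
   over the points whose orbits avoid the boundaries. *)
From HB Require Import structures.
From mathcomp Require Import all_boot all_order all_algebra generic_quotient lra.
From mathcomp Require Import all_classical all_reals all_analysis.
From Stdlib Require Import Relation_Operators.
Require Import Defs.
Set Implicit Arguments.
Unset Strict Implicit.
Unset Printing Implicit Defensive.
Import Order.TTheory GRing.Theory Num.Theory.
Import numFieldNormedType.Exports.
Local Open Scope classical_set_scope.
Local Open Scope ring_scope.

(** * Suspension flows *)

(** [S] need not be closed, and [rho] may jump where the next hit falls on the flow boundary of [S],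
    so return times do not pass to limits of codes by themselves. Hence a limit code [y] is assigned
    a limit of whole pairs [(x, rho x)]. Row 0 of [y] pins down the limit of [x], row 1 that of
    [phi (rho x) x]. Two times in [[a, b]] leading from one point to the same end point differ by
    less than [b], which no period allows, so the limiting time is determined too. Uniqueness and
    compactness of [X * [a, b]] then give continuity in [y]. Exceptional sets are measured by their
    whole orbits: this makes nullity invariant under sliding along the flow, and it already follows
    from nullity of one flow box. The suspension is handled as a quotient of all of [Y * R] by the
    powers of one homeomorphism [shear]. There the flow is a translation, and a map out of the
    suspension is a [shear]-invariant map on [Y * R]. *)

Section continuity.
Context {R : realType} {A B C : topologicalType}.

Lemma continuous_compose (f : A -> B) (g : B -> C) :
  continuous f -> continuous g -> continuous (fun a => g (f a)).
Proof. by move=> cf cg a; apply: continuous_comp; [exact: cf|exact: cg]. Qed.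

Lemma continuous_fst : continuous (@fst A B).
Proof. by move=> a; exact: cvg_fst. Qed.

Lemma continuous_snd : continuous (@snd A B).
Proof. by move=> a; exact: cvg_snd. Qed.

Lemma continuous_pair (f : A -> B) (g : A -> C) :
  continuous f -> continuous g -> continuous (fun a => (f a, g a)).
Proof. by move=> cf cg a; exact: cvg_pair (cf a) (cg a). Qed.

Lemma continuous_add (f g : A -> R) :
  continuous f -> continuous g -> continuous (fun a => f a + g a).
Proof. by move=> cf cg a; apply: cvgD; [exact: cf|exact: cg]. Qed.

Lemma continuous_sub (f g : A -> R) :
  continuous f -> continuous g -> continuous (fun a => f a - g a).
Proof. by move=> cf cg a; apply: cvgB; [exact: cf|exact: cg]. Qed.

Lemma closed_preimage (f : A -> B) (D : set B) :
  continuous f -> closed D -> closed (f @^-1` D).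
Proof. by move=> cf cD; apply: closed_comp => // a _; exact: cf. Qed.

Lemma near_continuous_gt (f : A -> R) a z :
  continuous f -> z < f a -> \forall w \near a, z < f w.
Proof. by move=> cf za; apply: (cvgr_gt (f a)) za; exact: cf. Qed.

End continuity.

Section suspension_flow.
Local Open Scope quotient_scope.
Context {R : realType} {Y : topologicalType} (T T' : Y -> Y) (r : Y -> R) (c : R).
Context (cT : continuous T) (cT' : continuous T').
Context (TK : cancel T T') (T'K : cancel T' T).
Context (cr : continuous r) (c0 : 0 < c) (cle : forall y, c <= r y).
Implicit Types (v w : Y * R) (p q : under_roof r).

Definition shear v : Y * R := (T v.1, v.2 - r v.1).
Definition shear_inv v : Y * R := (T' v.1, v.2 + r (T' v.1)).

Lemma shearK : cancel shear shear_inv.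
Proof. by move=> [y u]; rewrite /shear /shear_inv /= TK subrK. Qed.

Lemma shear_invK : cancel shear_inv shear.
Proof. by move=> [y u]; rewrite /shear /shear_inv /= T'K addrK. Qed.

(** Two forward exponents stand for one integer power, as [shear] is invertible. *)
Definition same_orbit v w := exists m k, iter m shear v = iter k shear w.

Lemma same_orbit_refl v : same_orbit v v.
Proof. by exists 0%N, 0%N. Qed.

Lemma same_orbit_sym v w : same_orbit v w -> same_orbit w v.
Proof. by move=> [m [k h]]; exists k, m. Qed.

Lemma same_orbit_trans v w u : same_orbit v w -> same_orbit w u -> same_orbit v u.
Proof.
move=> [m [k h]] [m' [k' h']]; exists (m' + m)%N, (k + k')%N.
by rewrite iterD h -iterD addnC iterD h' -iterD.
Qed.

Lemma same_orbit_shear v : same_orbit (shear v) v.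
Proof. by exists 0%N, 1%N. Qed.

Lemma same_orbit_shear_inv v : same_orbit (shear_inv v) v.
Proof. by exists 1%N, 0%N; rewrite /= shear_invK. Qed.

Lemma mem_under_roof v : 0 <= v.2 <= r v.1 -> v \in under_roof r.
Proof. by rewrite inE. Qed.

(** Each [shear] or [shear_inv] taken towards the under-roof domain lowers the absolute height by at
    least [c] until the domain is reached, so the induction runs on a multiple of [c] bounding that
    height. *)
Lemma same_orbit_under_roof v : exists p, same_orbit v (val p).
Proof.
have [n] : exists n : nat, `|v.2| <= n%:R * c.
  exists (Num.truncn (`|v.2| / c)).+1.
  by rewrite -ler_pdivrMr// ltW// truncnS_gt.
elim: n v => [|n IH] [y u] /=.
  rewrite mul0r normr_le0 => /eqP ->.
  have h : (y, 0) \in under_roof r by apply: mem_under_roof; rewrite lexx (le_trans (ltW c0)).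
  by exists (SigSub h); exact: same_orbit_refl.
rewrite -natr1 mulrDl mul1r ler_norml => /andP[u1 u2].
have cy := cle y; have cy' := cle (T' y).
have [u0|u0] := ltP u 0; last first.
  have [ur|ru] := leP u (r y).
    have h : (y, u) \in under_roof r by apply: mem_under_roof; rewrite u0 ur.
    by exists (SigSub h); exact: same_orbit_refl.
  have [|p hp] := IH (shear (y, u)).
    by rewrite /= ger0_norm ?subr_ge0 ?(ltW ru)//; lra.
  by exists p; apply: same_orbit_trans hp; apply/same_orbit_sym/same_orbit_shear.
have [ur|ru] := leP 0 (u + r (T' y)).
  have h : shear_inv (y, u) \in under_roof r by apply: mem_under_roof; rewrite /= ur /=; lra.
  by exists (SigSub h); apply/same_orbit_sym/same_orbit_shear_inv.
have [|p hp] := IH (shear_inv (y, u)).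
  by rewrite /= ltr0_norm //; lra.
by exists p; apply: same_orbit_trans hp; apply/same_orbit_sym/same_orbit_shear_inv.
Qed.

Lemma iter_shear_lt0 n v : v.2 <= 0 -> (iter n.+1 shear v).2 < 0.
Proof.
move=> v0; elim: n => [|n IH]; rewrite iterS /=.
  by have := cle v.1; move: c0 => ? ?; lra.
have := cle (iter n.+1 shear v).1; move: IH => /= ? ?; move: c0 => ?; lra.
Qed.

(** Points under the roof are at most one [shear] apart on their orbit: the first step already
    brings the height down to 0 or less, and any further one makes it negative. A single step must
    lead from the roof to the floor, which is the gluing. *)
Lemma same_orbit_pt p q :
  same_orbit (val p) (val q) -> suspension_pt T p = suspension_pt T q.
Proof.
have key j (p' q' : under_roof r) :
    iter j shear (val q') = val p' -> suspension_pt T q' = suspension_pt T p'.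
  case: j => [/val_inj -> //|[|j]].
    move=> h; apply/eqmodP/asboolP; apply: rst_step.
    have /andP[q0 qr] := set_mem (valP q'); have /andP[p0 pr] := set_mem (valP p').
    rewrite -h /= in p0.
    have e : (val q').2 = r (val q').1 by lra.
    exists (val q').1; split; first by rewrite -e -surjective_pairing.
    by rewrite -h /= /shear e subrr.
  rewrite iterSr => h.
  have /andP[q0 qr] := set_mem (valP q'); have /andP[p0 pr] := set_mem (valP p').
  have : (iter j.+1 shear (shear (val q'))).2 < 0 by apply: iter_shear_lt0; rewrite /= subr_le0.
  by rewrite h ltNge p0.
have inj n : injective (iter n shear).
  by elim: n => [//|n IH] v w /= /(can_inj shearK) /IH.
move=> [m [k h]]; have [mk|/ltnW km] := leqP m k.
  apply/esym/(key (k - m)%N); apply: (inj m).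
  by rewrite -iterD subnKC.
apply: (key (m - k)%N); apply: (inj k).
by rewrite -iterD subnKC.
Qed.

(** The quotient map of [Y * R] by the group generated by [shear], with the suspension as its
    target. *)
Definition unroll v : suspension T r := suspension_pt T (projT1 (cid (same_orbit_under_roof v))).

Lemma unroll_under_roof p : unroll (val p) = suspension_pt T p.
Proof.
by rewrite /unroll; case: cid => q /= h; apply: same_orbit_pt; exact: same_orbit_sym.
Qed.

Lemma unroll_eq v w : unroll v = unroll w <-> same_orbit v w.
Proof.
rewrite /unroll; case: cid => p /= vp; case: cid => q /= wq; split.
  move=> /eqmodP/asboolP pq; apply: same_orbit_trans vp _.
  apply: same_orbit_trans (same_orbit_sym wq).
  elim: pq {wq} => [p' q' [y [-> ->]]|p'|p' q' _|p' q' s _ h _].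
  - have -> : (T y, 0) = shear (y, r y) by rewrite /shear /= subrr.
    exact/same_orbit_sym/same_orbit_shear.
  - exact: same_orbit_refl.
  - exact: same_orbit_sym.
  - exact: same_orbit_trans.
move=> vw; apply: same_orbit_pt; apply: same_orbit_trans (same_orbit_sym vp) _.
exact: same_orbit_trans wq.
Qed.

Lemma unroll_shear v : unroll (shear v) = unroll v.
Proof. exact/unroll_eq/same_orbit_shear. Qed.

Lemma unroll_shear_inv v : unroll (shear_inv v) = unroll v.
Proof. exact/unroll_eq/same_orbit_shear_inv. Qed.

Lemma unroll_surj z : exists p, z = unroll (val p).
Proof.
by exists (repr z); rewrite unroll_under_roof /suspension_pt; exact/esym/reprK.
Qed.

Lemma unroll_surj_lt z : exists y s, [/\ 0 <= s, s < r y & z = unroll (y, s)].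
Proof.
have [p ->] := unroll_surj z; case: p => -[y s] ys /=.
have /andP[/= s0] := set_mem ys; rewrite le_eqVlt => /predU1P[sr|sr]; last first.
  by exists y, s.
exists (T y), 0; split => //; first exact: lt_le_trans (cle _).
by rewrite -(unroll_shear (y, s)) /shear /= sr subrr.
Qed.

Lemma shear_continuous : continuous shear.
Proof.
apply: continuous_pair; first exact: continuous_compose continuous_fst cT.
exact: continuous_sub continuous_snd (continuous_compose continuous_fst cr).
Qed.

Lemma shear_inv_continuous : continuous shear_inv.
Proof.
have cfT' : continuous (fun v => T' v.1) by exact: continuous_compose continuous_fst cT'.
apply: continuous_pair; first exact: cfT'.
exact: continuous_add continuous_snd (continuous_compose cfT' cr).
Qed.

Lemma iter_continuous (A : topologicalType) (f : A -> A) n :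
  continuous f -> continuous (iter n f).
Proof.
move=> cf; elim: n => [|n IH]; first by move=> a; exact: cvg_id.
exact: continuous_compose IH cf.
Qed.

Lemma unroll_open (U : set (Y * R)) : open U -> open (unroll @` U).
Proof.
move=> oU; rewrite /open/= /quotient_open.
(* The saturation of [U] is the union of its translates by all powers of [shear], each of which is
   open. *)
rewrite (_ : _ @^-1` _ = val @^-1`
   (\bigcup_n (iter n shear @^-1` U `|` iter n shear_inv @^-1` U))); last first.
  apply/seteqP; split => p /=.
    move=> [v Uv]; rewrite -/(suspension_pt T p) -unroll_under_roof => /unroll_eq[m [k h]].
    have Kiter f g n : cancel f g -> cancel (iter n f : Y * R -> _) (iter n g).
      by move=> fK; elim: n => [//|n IH] w; rewrite iterSr iterS fK IH.
    have [mk|/ltnW km] := leqP m k.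
      exists (k - m)%N => //; left => /=.
      rewrite (_ : iter (k - m) shear (val p) = v)//.
      apply: (can_inj (Kiter _ _ m shearK)).
      by rewrite -iterD subnKC// h.
    exists (m - k)%N => //; right => /=.
    rewrite (_ : iter (m - k) shear_inv (val p) = v)//.
    apply: (can_inj (Kiter _ _ (m - k)%N shearK)).
    rewrite (Kiter _ _ _ shear_invK); apply: (can_inj (Kiter _ _ k shearK)).
    by rewrite -iterD subnKC.
  move=> [n _ []] /= h; [exists (iter n shear (val p))|exists (iter n shear_inv (val p))] => //;
    rewrite -/(suspension_pt T p) -unroll_under_roof; elim: (n) => [//|k IH] /=.
    by rewrite unroll_shear.
  by rewrite unroll_shear_inv.
have /continuousP : continuous (val : under_roof r -> Y * R) by exact: initial_continuous.
apply; apply: bigcup_open => n _; apply: openU.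
  by move/continuousP: (@iter_continuous _ _ n shear_continuous); exact.
by move/continuousP: (@iter_continuous _ _ n shear_inv_continuous); exact.
Qed.

(* Near a point at height 0 the under-roof domain must be completed by the top
   of the fibre over [T' y], reached through [shear_inv]. *)
Lemma unroll_continuous : continuous unroll.
Proof.
have gap_continuous : continuous (fun w : Y * R => r w.1 - w.2).
  exact: continuous_sub (continuous_compose continuous_fst cr) continuous_snd.
(* Relative to the under-roof domain [unroll] is the quotient projection; near a point off this
   closed domain the claim is vacuous. *)
have loc (V : set (suspension T r)) : open V -> forall v, (unroll @^-1` V) v ->
    \forall w \near v, under_roof r w -> V (unroll w).
  move=> oV v Vv.
  have : open ((fun p : under_roof r => suspension_pt T p) @^-1` V) by exact: oV.
  rewrite openE => opV.
  have [vr|nvr] := pselect (under_roof r v).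
    have h : v \in under_roof r by rewrite inE.
    have := opV (SigSub h); rewrite /= -unroll_under_roof => /(_ Vv).
    rewrite /interior nbhsE /= => -[W [[A oA <-] /= Av] WV].
    apply: filterS (open_nbhs_nbhs (conj oA Av)) => w Aw wr.
    have hw : w \in under_roof r by rewrite inE.
    by have := WV (SigSub hw) Aw; rewrite /= -unroll_under_roof.
  have : open (~` under_roof r).
    apply: closed_openC.
    have -> : under_roof r = [set w | 0 <= w.2] `&` [set w | 0 <= r w.1 - w.2].
      by apply/seteqP; split=> w; rewrite /under_roof /= subr_ge0;
        [move=> /andP[]|move=> [-> ->]].
    apply: closedI.
      exact: closed_preimage continuous_snd (@closed_ge _ 0).
    exact: closed_preimage gap_continuous (@closed_ge _ 0).
  by move=> o; apply: filterS (open_nbhs_nbhs (conj o nvr)) => w nw /nw.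
have base y s (V : set (suspension T r)) : open V -> 0 <= s < r y ->
    V (unroll (y, s)) -> nbhs (y, s) (unroll @^-1` V).
  move=> oV /andP[s0 sr] Vys.
  have n1 := loc V oV (y, s) Vys.
  have n2 : \forall w \near (y, s), under_roof r (shear_inv w) -> V (unroll (shear_inv w)).
    have := loc V oV (shear_inv (y, s)); rewrite /= unroll_shear_inv => /(_ Vys).
    exact: shear_inv_continuous.
  (* From a height above [- c], [shear_inv] lands at a positive height. *)
  have n3 : \forall w \near (y, s), - c < w.2.
    by apply: near_continuous_gt; [exact: continuous_snd|move: c0 => ? /=; lra].
  have n4 : \forall w \near (y, s), 0 < r w.1 - w.2.
    by apply: (near_continuous_gt gap_continuous); rewrite /= subr_gt0.
  near=> w.
  have w3 : - c < w.2 by near: w.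
  have w4 : 0 < r w.1 - w.2 by near: w.
  have [w0|w0] := leP 0 w.2.
    apply: (near n1 w) => //; rewrite /under_roof /=; apply/andP; split => //; lra.
  rewrite /= -unroll_shear_inv; apply: (near n2 w) => //.
  by have := cle (T' w.1); move=> h; rewrite /under_roof /=; apply/andP; split; lra.
apply/continuousP => V oV; rewrite openE => v Vv.
(* Powers of [shear] are homeomorphisms that [unroll] does not see, so [v] may be replaced by a
   point with height in [[0, r y[]. *)
have [y [s [s0 sr e]]] := unroll_surj_lt (unroll v).
have /unroll_eq[m [k h]] := e.
have nk : nbhs (iter k shear (y, s)) (unroll @^-1` V).
  have un u : unroll (iter k shear_inv u) = unroll u.
    by elim: (k) => [//|j IH]; rewrite iterS unroll_shear_inv.
  rewrite (_ : _ @^-1` V = iter k shear_inv @^-1` (unroll @^-1` V)); last first.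
    by apply/seteqP; split => u /=; rewrite un.
  apply: (@iter_continuous _ _ k shear_inv_continuous).
  have -> : iter k shear_inv (iter k shear (y, s)) = (y, s).
    by elim: (k) => [//|j IH]; rewrite iterSr iterS shearK IH.
  by apply: base => //; [rewrite s0 sr|rewrite -e].
rewrite -h in nk.
have um u : unroll (iter m shear u) = unroll u.
  by elim: (m) => [//|j IH]; rewrite iterS unroll_shear.
rewrite /interior (_ : _ @^-1` V = iter m shear @^-1` (unroll @^-1` V)); last first.
  by apply/seteqP; split => u /=; rewrite um.
exact: (@iter_continuous _ _ m shear_continuous).
Unshelve. all: by end_near. Qed.

Definition shift_time t v : Y * R := (v.1, v.2 + t).

Lemma iter_shear_shift n t v : iter n shear (shift_time t v) = shift_time t (iter n shear v).
Proof. by elim: n => [//|n IH]; rewrite !iterS IH /shear /shift_time /= addrAC. Qed.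

Definition suspension_flow t (z : suspension T r) : suspension T r :=
  unroll (shift_time t (val (repr z : under_roof r))).

Lemma suspension_flow_unroll t v :
  suspension_flow t (unroll v) = unroll (shift_time t v).
Proof.
rewrite /suspension_flow; apply/unroll_eq.
have /unroll_eq[m [k h]] : unroll (val (repr (unroll v))) = unroll v.
  by rewrite unroll_under_roof /suspension_pt; exact: reprK.
by exists m, k; rewrite !iter_shear_shift h.
Qed.

Lemma suspension_flow_is_flow : is_suspension_flow suspension_flow.
Proof.
split; last first.
  move=> p q t h; rewrite -!unroll_under_roof suspension_flow_unroll.
  by rewrite h.
split.
- move=> z; have [p ->] := unroll_surj z; rewrite suspension_flow_unroll.
  by rewrite /shift_time addr0 -surjective_pairing.
- move=> s t z; have [p ->] := unroll_surj z.
  by rewrite !suspension_flow_unroll /shift_time /= addrAC addrA.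
move=> [t z]; have [p ->] := unroll_surj z.
move=> V /=; rewrite suspension_flow_unroll => /unroll_continuous hV.
have cs : continuous (fun a : R * (Y * R) => shift_time a.1 a.2).
  apply: continuous_pair; first exact: continuous_compose continuous_snd continuous_fst.
  exact: continuous_add (continuous_compose continuous_snd continuous_snd) continuous_fst.
have /cs [[A B] [/= At Bp] AB] :
  nbhs ((fun a : R * (Y * R) => shift_time a.1 a.2) (t, val p)) (unroll @^-1` V) by [].
(* Openness of [unroll] carries the neighbourhood [B] down to the suspension, which gives continuity
   jointly in time and point. *)
have nB : nbhs (unroll (val p)) (unroll @` B).
  apply: (@filterS _ _ _ (unroll @` interior B)).
    by apply: image_subset; exact: interior_subset.
  by apply: open_nbhs_nbhs; split; [apply/unroll_open/open_interior|exists (val p)].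
exists (A, unroll @` B) => //= -[t' z'] /= [At' [v Bv <-]].
by rewrite suspension_flow_unroll; exact: (AB (t', v)).
Qed.

Lemma lift_unroll_exists (Z : topologicalType) (g : Y * R -> Z) :
  continuous g -> (forall v, g (shear v) = g v) ->
  exists2 f : suspension T r -> Z, continuous f & forall v, f (unroll v) = g v.
Proof.
move=> cg gshear; pose f (z : suspension T r) := g (val (repr z : under_roof r)).
have fE v : f (unroll v) = g v.
  have /unroll_eq[m [k h]] : unroll (val (repr (unroll v))) = unroll v.
    by rewrite unroll_under_roof /suspension_pt; exact: reprK.
  have giter n w : g (iter n shear w) = g w by elim: n => [//|n <-]; rewrite iterS gshear.
  by rewrite /f -(giter m) h giter.
exists f => //; apply/quotient_continuous.
rewrite (_ : f \o _ = g \o (val : under_roof r -> Y * R)); last first.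
  by apply/funext => p /=; rewrite -fE unroll_under_roof.
by apply: continuous_compose cg; exact: initial_continuous.
Qed.

End suspension_flow.

(** * Spaces of codes *)

Section codes.
Context {R : realType} {I : countType}.
Implicit Types (c d e : I -> bool) (n : nat).

Definition agree n c d := forall i, (pickle i < n)%N -> c i = d i.

Definition differ_at c d : pred nat :=
  fun n => `[< exists i, pickle i = n /\ c i != d i >].

(** The usual ultrametric of a Cantor space, along the enumeration [pickle]. *)
Definition code_dist c d : R :=
  if pselect (exists n, differ_at c d n) is left h then 2 ^- (ex_minn h) else 0.

Lemma code_distP c d :
  (c = d /\ code_dist c d = 0) \/
  exists n, [/\ code_dist c d = 2 ^- n, agree n c d & ~ agree n.+1 c d].
Proof.
rewrite /code_dist; case: pselect => [h|nh].
  right; case: ex_minnP => n /asboolP[i [ni cdi]] nmin; exists n; split => //.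
    move=> j jn; apply/eqP; apply: contraPT jn => cdj.
    by apply/negP; rewrite -leqNgt; apply: nmin; apply/asboolP; exists j.
  by move=> /(_ i); rewrite ni ltnSn => /(_ isT) e; rewrite e eqxx in cdi.
left; split => //; apply/funext => i; apply/eqP/negPn/negP => cdi.
by apply: nh; exists (pickle i); apply/asboolP; exists i.
Qed.

Lemma half_pow_le n m : ((2 : R) ^- n <= 2 ^- m) = (m <= n)%N.
Proof. by rewrite lef_pV2 ?posrE ?exprn_gt0// ler_eXn2l// ltr1n. Qed.

Lemma code_dist_le n c d : (code_dist c d <= 2 ^- n) <-> agree n c d.
Proof.
have [[-> ->]|[m [-> am nam]]] := code_distP c d.
  by split => // _; rewrite invr_ge0 exprn_ge0.
rewrite half_pow_le; split => [nm i ni|an]; first exact/am/(leq_trans ni).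
by rewrite leqNgt; apply/negP => mn; apply: nam => i im; apply/an/(leq_trans im).
Qed.

Lemma code_dist_lt n c d : code_dist c d < 2 ^- n -> agree n.+1 c d.
Proof.
have [[-> ->]//|[m [-> am nam]]] := code_distP c d.
by rewrite ltNge half_pow_le -ltnNge => nm i ni; exact/am/(leq_trans ni).
Qed.

Lemma code_dist_ge0 c d : 0 <= code_dist c d.
Proof. by have [[_ ->]//|[m [-> _ _]]] := code_distP c d; rewrite invr_ge0 exprn_ge0. Qed.

Lemma code_distxx c : code_dist c c = 0.
Proof. by have [[_ ->]//|[n [_ _ []]]] := code_distP c c. Qed.

Lemma code_dist_eq0 c d : code_dist c d = 0 -> c = d.
Proof.
have [[->]//|[m [-> _ _]]] := code_distP c d => /eqP.
by rewrite invr_eq0 expf_eq0 pnatr_eq0 andbF.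
Qed.

Lemma agree_sym n c d : agree n c d -> agree n d c.
Proof. by move=> h i /h. Qed.

Lemma code_dist_sym c d : code_dist c d = code_dist d c.
Proof.
suff le c' d' : code_dist c' d' <= code_dist d' c' by apply/eqP; rewrite eq_le !le.
have [[-> ->]//|[n [-> an _]]] := code_distP d' c'.
exact/code_dist_le/agree_sym.
Qed.

Lemma code_dist_triangle d c e : code_dist c e <= code_dist c d + code_dist d e.
Proof.
have [[_ ->]|[n [-> _ nan]]] := code_distP c e.
  by rewrite addr_ge0// code_dist_ge0.
rewrite leNgt; apply/negP => lt; apply: nan => i ni.
have cd : code_dist c d < 2 ^- n by apply: le_lt_trans lt; rewrite lerDl code_dist_ge0.
have de : code_dist d e < 2 ^- n by apply: le_lt_trans lt; rewrite lerDr code_dist_ge0.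
by rewrite (code_dist_lt cd)// (code_dist_lt de).
Qed.

Lemma filter_agree T (F : set_system T) (f : T -> I -> bool) c n :
  Filter F -> (forall i, F [set t | f t i = c i]) -> F [set t | agree n c (f t)].
Proof.
move=> FF h; elim: n => [|n IH]; first by apply: filterS filterT => y _ i.
have [[i ni]|nex] := pselect (exists i : I, pickle i = n).
  apply: filterS (filterI IH (h i)) => y [/= an yi] j.
  rewrite ltnS leq_eqVlt => /predU1P[jn|/an//].
  by have -> : j = i by apply: (pcan_inj pickleK); rewrite jn ni.
apply: filterS IH => y /= an j; rewrite ltnS leq_eqVlt => /predU1P[jn|/an//].
by exfalso; apply: nex; exists j.
Qed.

End codes.

(* [R] is a phantom parameter: it only lets the metric structure be inferred. *)
Definition code_space (R : realType) (I : countType) (K : set (I -> bool)) : Type :=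
  {c : I -> bool | K c}.

HB.instance Definition _ (R : realType) (I : countType) (K : set (I -> bool)) :=
  gen_eqMixin (code_space R K).
HB.instance Definition _ (R : realType) (I : countType) (K : set (I -> bool)) :=
  gen_choiceMixin (code_space R K).

Section code_space.
Context {R : realType} {I : countType} (K : set (I -> bool)).

Let dist (x y : code_space R K) : R := code_dist (sval x) (sval y).

Lemma code_space_distxx x : dist x x = 0.
Proof. exact: code_distxx. Qed.

Lemma code_space_inj (x y : code_space R K) : sval x = sval y -> x = y.
Proof.
by case: x y => [x Kx] [y Ky] /= e; subst y; congr exist; exact: Prop_irrelevance.
Qed.

Lemma code_space_dist_eq0 x y : dist x y = 0 -> x = y.
Proof. by move=> /code_dist_eq0; exact: code_space_inj. Qed.

Lemma code_space_dist_sym x y : dist x y = dist y x.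
Proof. exact: code_dist_sym. Qed.

Lemma code_space_dist_triangle y x z : dist x z <= dist x y + dist y z.
Proof. exact: code_dist_triangle. Qed.

HB.instance Definition _ := isMetric.Build R (code_space R K)
  code_space_distxx code_space_dist_eq0 code_space_dist_sym code_space_dist_triangle.

Lemma near_agree n (x : code_space R K) : \forall y \near x, agree n (sval x) (sval y).
Proof.
have n0 : 0 < (2 : R) ^- n by rewrite invr_gt0 exprn_gt0.
apply: filterS (nbhsx_ballx x _ n0) => y; rewrite ballEmdist /=.
by move=> /ltW /code_dist_le.
Qed.

Lemma near_code i (x : code_space R K) : \forall y \near x, sval y i = sval x i.
Proof. by apply: filterS (near_agree (pickle i).+1 x) => y /(_ i) ->. Qed.

Lemma cvg_code (F : set_system (code_space R K)) {FF : Filter F} (x : code_space R K) :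
  (forall i, F [set y | sval y i = sval x i]) -> F --> x.
Proof.
move=> h.
apply/fcvg_ballP => e e0.
have [n ne] : exists n, (2 : R) ^- n < e.
  exists (Num.truncn e^-1).+1.
  rewrite invf_plt ?posrE ?exprn_gt0//.
  by apply: lt_le_trans (truncnS_gt _) _; rewrite -natrX ler_nat ltnW// ltn_expl.
apply: filterS (filter_agree n FF h) => y an; rewrite ballEmdist /=.
by apply: le_lt_trans ne; exact/code_dist_le.
Qed.

(** Tychonoff by ultrafilters: an ultrafilter decides every coordinate, and the decided values form
    a code that lies in [K] because [K] is closed. *)
Lemma code_space_compact :
  (forall c, (forall n, exists2 d, K d & agree n c d) -> K c) ->
  compact [set: code_space R K].
Proof.
move=> clK; rewrite compact_ultra => F FU _.
pose c i : bool := `[< F [set y | sval y i = true] >].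
have Fc i : F [set y | sval y i = c i].
  rewrite /c; have [h|h] := in_ultra_setVsetC [set y | sval y i = true] FU.
    by apply: filterS (h) => y /= ->; apply/esym/asboolP.
  apply: filterS (h) => y /= /negP/negbTE ->.
  apply/esym/asboolPn => h'.
  by have [z [/= zi /(_ zi)]] := filter_ex (filterI h' h).
have Kc : K c.
  apply: clK => n; have [[d Kd] /= ad] := filter_ex (filter_agree n _ Fc).
  by exists d.
by exists (exist _ c Kc); split => //; exact: cvg_code.
Qed.

Lemma code_space_zero_dimensional : zero_dimensional (code_space R K).
Proof.
move=> x y xy; have [i xyi] : exists i, sval x i <> sval y i.
  apply: contrapT => /forallNP h; move/eqP: xy; apply; apply: code_space_inj.
  by apply/funext => i; exact: contrapT (h i).
exists [set z | sval z i = sval x i]; split => //; last by move=> /= /esym.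
split; rewrite -?openC openE => z /= zi; rewrite /interior.
  by apply: filterS (near_code i z) => w /= ->.
by apply: filterS (near_code i z) => w /= ->.
Qed.

End code_space.

(** * The extension coded by returns to a section *)

Section flow_facts.
Context {R : realType} {X : topologicalType} (phi : R -> X -> X).
Context (phiP : is_flow phi).
Implicit Types (S E : set X) (x : X).

Lemma flow0 x : phi 0 x = x.
Proof. by case: phiP. Qed.

Lemma flowD s t x : phi (s + t) x = phi s (phi t x).
Proof. by case: phiP. Qed.

Lemma flowK t : cancel (phi t) (phi (- t)).
Proof. by move=> x; rewrite -flowD addNr flow0. Qed.

Lemma flowNK t : cancel (phi (- t)) (phi t).
Proof. by move=> x; rewrite -flowD subrr flow0. Qed.

Lemma flow_continuous2 : continuous (fun p : R * X => phi p.1 p.2).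
Proof. by case: phiP. Qed.

Lemma flow_continuous t : continuous (phi t).
Proof.
have c : continuous (fun x : X => (t, x)).
  by apply: continuous_pair => x; [exact: cvg_cst|exact: cvg_id].
exact: continuous_compose c flow_continuous2.
Qed.

Lemma near_flow x (V : set X) : nbhs x V ->
  \forall y \near x & t \near (0 : R), V (phi t y).
Proof.
move=> Vx; have := @flow_continuous2 (0, x); rewrite /continuous_at /= flow0.
move=> /(_ _ Vx) [[A B] [/= A0 Bx] AB]; exists (B, A) => //= -[y t] [/= By At].
exact: (AB (t, y)).
Qed.

(* The flow interior, tested at all scales at once. *)
Definition flow_inner S x :=
  S x /\ forall e, 0 < e -> nbhs x (flow_image phi `[- e, e] S).

End flow_facts.

(** * Return times to a section with separated hits *)

Lemma discrete_has_min {R : realType} (P : set R) (a b : R) :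
  0 < a -> P !=set0 -> (forall t, P t -> b < t) ->
  (forall t u, P t -> P u -> `|t - u| <= a -> t = u) ->
  exists2 t, P t & forall u, P u -> t <= u.
Proof.
move=> a0 P0 Pb Pa.
have Pinf : has_inf P by split => //; exists b => t /Pb /ltW.
(* A point of [P] within [a] of the infimum is least, since a smaller one would be within [a] of
   it. *)
have [t Pt ti] := inf_adherent a0 Pinf.
exists t => // u Pu; rewrite leNgt; apply/negP => ut.
have iu : inf P <= u by apply: ge_inf => //; case: Pinf.
suff e : u = t by rewrite e ltxx in ut.
by apply: Pa => //; rewrite ltr0_norm ?subr_lt0//; lra.
Qed.

Lemma next_hit_exists {R : realType} {X : topologicalType} (phi : R -> X -> X)
    (S : set X) (a b : R) :
  is_flow phi -> 0 < a ->
  (forall x t, S x -> S (phi t x) -> `|t| <= a -> t = 0) ->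
  (forall x, exists2 t, 0 < t <= b & S (phi t x)) ->
  exists rho : X -> R, forall x,
    [/\ 0 < rho x <= b, S (phi (rho x) x) & forall t, 0 < t -> S (phi t x) -> rho x <= t].
Proof.
move=> phiP a0 gap hit.
suff /choice[rho h] : forall x, exists t,
    [/\ 0 < t <= b, S (phi t x) & forall u, 0 < u -> S (phi u x) -> t <= u] by exists rho.
move=> x; have [t0 /andP[t00 t0b] St0] := hit x.
have [|t /= t_gt0|t u /= [_ St] [_ Su] tu|t [/= tp St] tmin] :=
    @discrete_has_min R [set t | 0 < t /\ S (phi t x)] a 0 a0.
- by exists t0.
- by case: t_gt0.
- apply/eqP; rewrite -subr_eq0; apply/eqP; apply: (gap (phi u x)) => //.
  by rewrite -flowD// subrK.
exists t; split => //; last by move=> u u0 Su; exact: tmin.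
by rewrite tp (le_trans _ t0b)// tmin.
Qed.

Section coding.
Context {R : realType} {X : metricType R} (phi : R -> X -> X).
Context (cX : compact [set: X]) (phiP : is_flow phi).
Context (S : set X) (a b : R) (a0 : 0 < a).
Context (gap : forall x t, S x -> S (phi t x) -> `|t| <= a -> t = 0).
Context (rho rho' : X -> R).
Context (rhoP : forall x, [/\ 0 < rho x <= b, S (phi (rho x) x) &
  forall t, 0 < t -> S (phi t x) -> rho x <= t]).
Context (rho'P : forall x, [/\ 0 < rho' x <= b, S (phi (- rho' x) x) &
  forall t, 0 < t -> S (phi (- t) x) -> rho' x <= t]).
Context (period : forall x t, phi t x = x -> `|t| <= b -> t = 0).
Context (C : nat * nat -> set X) (N : nat -> nat).
Context (C_cover : forall k x, S x -> exists2 i, (i < N k)%N & C (k, i) x).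
Context (C_small : forall k i x y, C (k, i) x -> C (k, i) y -> ball x k.+1%:R^-1 y).

Definition return_map x := phi (rho x) x.
Definition return_map_inv x := phi (- rho' x) x.

Lemma return_map_in x : S (return_map x).
Proof. by case: (rhoP x). Qed.

Lemma return_map_inv_in x : S (return_map_inv x).
Proof. by case: (rho'P x). Qed.

Lemma return_mapK x : S x -> return_map_inv (return_map x) = x.
Proof.
move=> Sx; have [/andP[r0 _] Sr rmin] := rhoP x.
have [/andP[r'0 _] Sr' r'min] := rho'P (return_map x).
suff e : rho' (return_map x) = rho x by rewrite /return_map_inv e /return_map flowK.
apply/eqP; rewrite eq_le r'min//=; last by rewrite /return_map flowK.
rewrite leNgt; apply/negP => lt; have := rmin (rho x - rho' (return_map x)).
rewrite subr_gt0 => /(_ lt); rewrite addrC flowD// => /(_ Sr'); lra.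
Qed.

Lemma return_map_invK x : S x -> return_map (return_map_inv x) = x.
Proof.
move=> Sx; have [/andP[r0 _] Sr rmin] := rho'P x.
have [/andP[r'0 _] Sr' r'min] := rhoP (return_map_inv x).
suff e : rho (return_map_inv x) = rho' x by rewrite /return_map e /return_map_inv flowNK.
apply/eqP; rewrite eq_le r'min//=; last by rewrite /return_map_inv flowNK.
rewrite leNgt; apply/negP => lt; have := rmin (rho' x - rho (return_map_inv x)).
rewrite subr_gt0 => /(_ lt); rewrite opprB flowD// => /(_ Sr'); lra.
Qed.

Lemma return_time_gt x : S x -> a < rho x.
Proof.
move=> Sx; have [/andP[r0 _] Sr _] := rhoP x; rewrite ltNge; apply/negP => ra.
by have := gap Sx Sr; rewrite gtr0_norm// => /(_ ra) e; rewrite e ltxx in r0.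
Qed.

Definition return_iter (n : int) : X -> X :=
  match n with Posz m => iter m return_map | Negz m => iter m.+1 return_map_inv end.

Lemma return_iterS n x : S x -> return_iter n (return_map x) = return_iter (n + 1) x.
Proof.
move=> Sx; case: n => [n|[|n]].
- by rewrite -PoszD addn1 [RHS]/= -iterS iterSr.
- by rewrite /= return_mapK.
rewrite (_ : Negz n.+1 + 1 = Negz n); last by rewrite !NegzE -(addn1 n.+1) PoszD opprD addrNK.
by rewrite /return_iter iterSr return_mapK.
Qed.

Notation index := (int * (nat * nat))%type.

Definition code x : index -> bool := fun i => `[< C i.2 (return_iter i.1 x) >].

Lemma code_return_map x n j : S x -> code (return_map x) (n, j) = code x (n + 1, j).
Proof. by move=> Sx; rewrite /code /= return_iterS. Qed.

Lemma code_return_map_inv x n j : S x -> code (return_map_inv x) (n, j) = code x (n - 1, j).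
Proof.
move=> Sx; rewrite -[in RHS](return_map_invK Sx) code_return_map; last exact: return_map_inv_in.
by rewrite subrK.
Qed.

Definition codes : set (index -> bool) := fun c => forall n, exists2 x, S x & agree n c (code x).

Lemma agree_reindex (g : index -> index) n : exists m, forall c d,
  agree m c d -> agree n (c \o g) (d \o g).
Proof.
elim: n => [|n [m mP]]; first by exists 0%N => c d _ i.
have [[i ni]|nex] := pselect (exists i : index, pickle i = n).
  exists (maxn m (pickle (g i)).+1) => c d h j; rewrite ltnS leq_eqVlt => /predU1P[jn|jn].
    have -> : j = i by apply: (pcan_inj pickleK); rewrite jn ni.
    by apply: h; rewrite leq_max ltnSn orbT.
  by apply: mP jn => l lm; apply: h; rewrite leq_max lm.
exists m => c d h j; rewrite ltnS leq_eqVlt => /predU1P[jn|jn]; last exact: mP jn.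
by exfalso; apply: nex; exists j.
Qed.

Definition shift_code (k : int) (c : index -> bool) : index -> bool :=
  fun i => c (i.1 + k, i.2).

Lemma shift_code_in k c : (k = 1 \/ k = - 1) -> codes c -> codes (shift_code k c).
Proof.
move=> hk cc n; have [m mP] := agree_reindex (fun i => (i.1 + k, i.2)) n.
have [x Sx /mP h] := cc m.
case: hk h => -> h.
  exists (return_map x); first exact: return_map_in.
  by move=> [l j] /h /= e; rewrite code_return_map.
exists (return_map_inv x); first exact: return_map_inv_in.
by move=> [l j] /h /= e; rewrite code_return_map_inv.
Qed.

Notation Y := (code_space R codes).

Definition shift (y : Y) : Y :=
  exist _ (shift_code 1 (sval y)) (shift_code_in (or_introl erefl) (svalP y)).
Definition shift_inv (y : Y) : Y :=
  exist _ (shift_code (- 1) (sval y)) (shift_code_in (or_intror erefl) (svalP y)).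

Lemma shiftK : cancel shift shift_inv.
Proof.
move=> y; apply: code_space_inj; apply/funext => -[n j].
by rewrite /= /shift_code /= addrNK.
Qed.

Lemma shift_invK : cancel shift_inv shift.
Proof.
move=> y; apply: code_space_inj; apply/funext => -[n j].
by rewrite /= /shift_code /= addrK.
Qed.

Lemma shift_continuous : continuous shift.
Proof.
move=> y; have FF := fmap_filter shift (nbhs_filter y).
by apply: (cvg_code (FF := FF)) => -[n j]; exact: near_code.
Qed.

Lemma shift_inv_continuous : continuous shift_inv.
Proof.
move=> y; have FF := fmap_filter shift_inv (nbhs_filter y).
by apply: (cvg_code (FF := FF)) => -[n j]; exact: near_code.
Qed.

Lemma codes_compact : compact [set: Y].
Proof.
apply: code_space_compact => c h n; have [d /(_ n)[x Sx dx] cd] := h n.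
by exists x => // i ni; rewrite cd// dx.
Qed.

(* [limit_data y q]: the pair [q] is a limit of [(x, rho x)] along points [x] of
   [S] whose codes converge to [y]. *)
Definition limit_data (y : Y) (q : X * R) := forall n V, nbhs q V ->
  exists x, [/\ S x, agree n (sval y) (code x) & V (x, rho x)].

(** At each scale [k], a true entry [(k, i)] in the common row puts the two approximating points
    into one set [C (k, i)], so their limits are arbitrarily close. Used with equal rows 0 or 1 for
    uniqueness of the limit data, and with row 0 of [shift y] against row 1 of [y] for
    equivariance. *)
Lemma limit_data_eq (y y' : Y) q q' (n n' : int) (h h' : X * R -> X) :
  continuous h -> continuous h' ->
  (forall x, S x -> return_iter n x = h (x, rho x)) ->
  (forall x, S x -> return_iter n' x = h' (x, rho x)) ->
  (forall j, sval y (n, j) = sval y' (n', j)) ->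
  limit_data y q -> limit_data y' q' -> h q = h' q'.
Proof.
move=> ch ch' hn hn' yy' yq yq'.
apply: (@metric_hausdorff R X) => A B Ah Bh.
have [e e0 eA] : exists2 e, 0 < e & ball (h q) e `<=` A by apply/nbhs_ballP.
have [e' e'0 eB] : exists2 e, 0 < e & ball (h' q') e `<=` B by apply/nbhs_ballP.
suff : ball (h q) e (h' q') by move=> qq'; exists (h' q'); split; [exact: eA|exact/eB/ballxx].
have [k ke] : exists k : nat, k.+1%:R^-1 < e / 2.
  exists (Num.truncn (e / 2)^-1).
  by rewrite invf_plt ?posrE ?divr_gt0// truncnS_gt.
(* The cover at scale [k] is finite, so agreement up to one bound [m] settles all of its entries in
   a row. *)
have big (l : int) : exists m, forall i, (i < N k)%N -> (pickle (l, (k, i)) < m)%N.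
  elim: (N k) => [|p [m mP]]; first by exists 0%N.
  exists (maxn m (pickle (l, (k, p))).+1) => i; rewrite ltnS leq_eqVlt => /predU1P[->|ip].
    by rewrite leq_max ltnSn orbT.
  by rewrite leq_max mP.
have [m mP] := big n; have [m' m'P] := big n'.
have e40 : 0 < e / 2 / 2 by rewrite !divr_gt0.
have /= [x [Sx yx hx]] := yq m _ (ch q _ (nbhsx_ballx _ _ e40)).
have /= [x' [Sx' yx' hx']] := yq' m' _ (ch' q' _ (nbhsx_ballx _ _ e40)).
have Sn : S (return_iter n x).
  by case: (n) => [[|l]|l] //=; [exact: return_map_in|exact: return_map_inv_in].
have [i iN Ci] := @C_cover k _ Sn.
have : sval y (n, (k, i)) by rewrite yx ?mP//; exact/asboolP.
rewrite yy' yx' ?m'P// => /asboolP /= Ci'.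
have := C_small Ci Ci'; rewrite hn// hn'// => bb.
have := ball_triangle (ball_triangle hx bb) (ball_sym hx').
by apply: le_ball; move: ke; set u := _^-1 => ke; lra.
Qed.

Lemma limit_data_exists y : exists q, limit_data y q /\ a <= q.2 <= b.
Proof.
pose D := [set: X] `*` `[a, b] : set (X * R).
have cD : compact D by apply: compact_setX => //; exact: segment_compact.
pose F : set_system (X * R) := [set A | exists n, forall x, S x ->
  agree n (sval y) (code x) -> A (x, rho x)].
have FF : ProperFilter F.
  split; first by move=> [n h]; have [x Sx yx] := svalP y n; exact: h yx.
  split.
  - by exists 0%N.
  - move=> A B [n hA] [m hB]; exists (maxn n m) => x Sx yx; split.
      by apply: hA => // i ni; apply: yx; rewrite leq_max ni.
    by apply: hB => // i ni; apply: yx; rewrite leq_max ni orbT.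
  - by move=> A B AB [n hA]; exists n => x Sx yx; exact/AB/hA.
have FD : F D.
  exists 0%N => x Sx _; split => //=; rewrite in_itv /= (ltW (return_time_gt Sx)).
  by case: (rhoP x) => /andP[].
have [q [[_ qab] qF]] := cD F FF FD; exists q; split; last first.
  by move: qab; rewrite /= in_itv.
move=> n V qV.
have FA : F [set p | exists x, [/\ S x, agree n (sval y) (code x) & p = (x, rho x)]].
  by exists n => x Sx yx; exists x.
by have [p [[x [Sx yx ->]] Vp]] := qF _ _ FA qV; exists x.
Qed.

Definition cluster_data y : X * R := projT1 (cid (limit_data_exists y)).

Lemma cluster_dataP y : limit_data y (cluster_data y).
Proof. by rewrite /cluster_data; case: cid => q []. Qed.

Lemma cluster_data_itv y : a <= (cluster_data y).2 <= b.
Proof. by rewrite /cluster_data; case: cid => q []. Qed.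

Definition base_pt y := (cluster_data y).1.
Definition roof y := (cluster_data y).2.

Lemma return_iter1 x : S x -> return_iter 1 x = phi (rho x) x.
Proof. by []. Qed.

Lemma limit_data_unique y q : a <= q.2 <= b -> limit_data y q -> q = cluster_data y.
Proof.
move=> /andP[qa qb] yq; have yq' := @cluster_dataP y.
have /andP[qa' qb'] := cluster_data_itv y.
have q1 : q.1 = (cluster_data y).1.
  exact: (limit_data_eq (n := 0) (n' := 0) continuous_fst continuous_fst _ _ _ yq yq').
have cf : continuous (fun p : X * R => phi p.2 p.1).
  exact: continuous_compose (continuous_pair continuous_snd continuous_fst)
    (flow_continuous2 phiP).
have q2 : phi q.2 q.1 = phi (cluster_data y).2 (cluster_data y).1.
  exact: (limit_data_eq (n := 1) (n' := 1) cf cf return_iter1 return_iter1 _ yq yq').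
rewrite [q]surjective_pairing [cluster_data y]surjective_pairing q1; congr pair.
apply/eqP; rewrite -subr_eq0; apply/eqP.
apply: (@period (phi (cluster_data y).2 (cluster_data y).1)).
  by rewrite -flowD// subrK -q2 q1.
by rewrite ler_norml; move: a0 => ?; apply/andP; split; lra.
Qed.

Lemma base_pt_shift y : base_pt (shift y) = phi (roof y) (base_pt y).
Proof.
have cf : continuous (fun p : X * R => phi p.2 p.1).
  exact: continuous_compose (continuous_pair continuous_snd continuous_fst)
    (flow_continuous2 phiP).
apply: (limit_data_eq (n := 0) (n' := 1) continuous_fst cf _ return_iter1 _
  (@cluster_dataP (shift y)) (@cluster_dataP y)) => //.
Qed.

(** A closed graph argument: failing to be limit data is an open condition on pair and code
    together, so by compactness the codes near [y] have no limit data outside a given neighbourhood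
    of [cluster_data y]. *)
Lemma cluster_data_continuous : continuous cluster_data.
Proof.
move=> y; pose D := [set: X] `*` `[a, b] : set (X * R).
have cD : compact D by apply: compact_setX => //; exact: segment_compact.
move=> U Uy; have cDU : compact (D `\` interior U).
  apply: (subclosed_compact _ cD); last by move=> q [].
  apply: closedI; last exact/open_closedC/open_interior.
  rewrite (_ : D = snd @^-1` `[a, b]); last by apply/seteqP; split=> [q []|q].
  exact: closed_preimage continuous_snd (@itv_closed _ _ a b).
have /compact_near_coveringP cov := cDU.
have : \forall y' \near y, D `\` interior U `<=` (fun q => ~ limit_data y' q).
  apply: (cov _ (nbhs y) (fun y' q => ~ limit_data y' q) (nbhs_filter y)).
  move=> q [[_ qab] nUq].
  have : ~ limit_data y q.
    move: qab; rewrite /= in_itv /= => qab yq; apply: nUq.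
    by rewrite (limit_data_unique qab yq).
  move=> /existsNP[n /existsNP[V /not_implyP[Vq nV]]].
  exists (interior V, [set y' | agree n (sval y) (sval y')]).
    by split; [exact: nbhs_interior|exact: near_agree].
  move=> [q' y'] [/= Vq' yy'] /(_ n V Vq')[x [Sx y'x Vx]]; apply: nV; exists x; split => //.
  by move=> i ni; rewrite yy'// y'x.
apply: filterS => y' h; apply: contrapT => nU.
apply: (h (cluster_data y')); last exact: cluster_dataP.
split; last by move=> /interior_subset.
by split => //=; rewrite in_itv; exact: cluster_data_itv.
Qed.

Lemma base_pt_continuous : continuous base_pt.
Proof. exact: continuous_compose cluster_data_continuous continuous_fst. Qed.

Lemma roof_continuous : continuous roof.
Proof. exact: continuous_compose cluster_data_continuous continuous_snd. Qed.

Lemma roof_ge y : a <= roof y.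
Proof. by case/andP: (cluster_data_itv y). Qed.

Lemma code_in_codes x : S x -> codes (code x).
Proof. by move=> Sx n; exists x. Qed.

Definition code_pt x (Sx : S x) : Y := exist _ (code x) (code_in_codes Sx).

(** The constant approximation by [x] itself is allowed in [limit_data]. This makes the extension
    surjective, since every point of [S] occurs as a base point. *)
Lemma cluster_data_code x (Sx : S x) : cluster_data (code_pt Sx) = (x, rho x).
Proof.
apply/esym/limit_data_unique => /=.
  by rewrite (ltW (return_time_gt Sx)); case: (rhoP x) => /andP[].
by move=> n V Vx; exists x; split => //; exact: nbhs_singleton.
Qed.

(** The two closures in the second clause meet in the boundary of [C j] relative to [S]. Both
    clauses range over the whole orbit, so that they pass to every return. *)
Definition regular_pt x :=
  [/\ forall s, closure S (phi s x) -> flow_inner phi S (phi s x)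
    & forall s j, ~ (closure (C j) (phi s x) /\ closure (S `\` C j) (phi s x))].

Lemma regular_pt_flow t x : regular_pt x -> regular_pt (phi t x).
Proof.
move=> [h1 h2]; split => s; first by rewrite -flowD//; exact: h1.
by move=> j; rewrite -flowD//; exact: h2.
Qed.

(** * Unique coding above regular points *)

Section over_regular_point.
Context (y : Y) (Ey : regular_pt (base_pt y)).

Lemma near_base_pt n (V : set X) e : nbhs (base_pt y) V -> 0 < e ->
  exists x, [/\ S x, agree n (sval y) (code x), V x & `|roof y - rho x| < e].
Proof.
move=> Vy e0; have nV : nbhs (cluster_data y) (fst @^-1` V `&` snd @^-1` ball (cluster_data y).2 e).
  apply: filterI; first exact: continuous_fst.
  by apply: (@continuous_snd X R (cluster_data y)); exact: nbhsx_ballx.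
by have [x [Sx yx [/= Vx ex]]] := cluster_dataP n nV; exists x.
Qed.

Lemma regular_base_pt : S (base_pt y).
Proof.
have [h1 _] := Ey; have := h1 0; rewrite flow0// => h.
apply: (h _).1 => V Vy; have [x [Sx _ Vx _]] := near_base_pt 0 Vy ltr01.
by exists x.
Qed.

(** The limit time [roof y] is a hit of [S], so the first return is no later. Were it earlier, it
    would take place in the flow interior of [S]; the points approximating [base_pt y] would then
    also return about that time, too early for their return times to tend to [roof y]. *)
Lemma regular_roof : roof y = rho (base_pt y).
Proof.
set x := base_pt y; set t := roof y; have [h1 _] := Ey.
have a_t : a <= t := roof_ge y.
have St : S (phi t x).
  apply: (h1 t _).1 => V Vt.
  have cf : continuous (fun p : X * R => phi p.2 p.1).
    exact: continuous_compose (continuous_pair continuous_snd continuous_fst)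
      (flow_continuous2 phiP).
  have [x' [Sx' _ Vx']] := cluster_dataP 0 (cf (cluster_data y) _ Vt).
  by exists (phi (rho x') x'); split => //; case: (rhoP x').
have [/andP[r0 _] Sr rmin] := rhoP x.
apply/eqP; rewrite eq_le rmin ?(lt_le_trans a0)// andbT leNgt; apply/negP => lt.
have [_ inner] := h1 (rho x) (subset_closure Sr).
(* The first bound keeps the perturbed hitting time positive, the second keeps it at least [e] below
   [t]. *)
pose e := Num.min (rho x / 2) ((t - rho x) / 2).
have e0 : 0 < e by rewrite lt_min !divr_gt0 ?subr_gt0.
have e1 : e <= rho x / 2 by rewrite ge_min lexx.
have e2 : e <= (t - rho x) / 2 by rewrite ge_min lexx orbT.
have := @flow_continuous _ _ _ phiP (rho x) x _ (inner e e0).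
move=> /(near_base_pt 0)/(_ e0)[x' [Sx' _ [v /= + [s Ss sx']]]].
rewrite in_itv /= => /andP[v1 v2] d.
have [_ _ r'min] := rhoP x'.
have : S (phi (rho x - v) x').
  by rewrite addrC flowD// -sx' flowK.
move=> /(r'min _ _) h; have {h} : rho x' <= rho x - v by apply: h; lra.
move: d; rewrite ltr_norml -/t => /andP[d1 d2] h; lra.
Qed.

Lemma regular_base_pt_shift : base_pt (shift y) = return_map (base_pt y).
Proof. by rewrite base_pt_shift regular_roof. Qed.

(** Off the relative boundary, membership in [C j] is constant on the points of [S] near
    [base_pt y], and some of these have codes agreeing with [y] at the entry in question. *)
Lemma regular_code0 j : sval y (0, j) = code (base_pt y) (0, j).
Proof.
set x := base_pt y; have [_ h2] := Ey.
have nC := h2 0 j; rewrite flow0// -/x in nC.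
have sep (A : set X) : ~ closure A x -> exists2 V, nbhs x V & V `&` A = set0.
  move=> /existsNP[V /not_implyP[Vx nV]]; exists V => //.
  by rewrite setIC; apply: contrapT => /eqP/set0P.
have sub x' : agree (pickle ((0, j) : index)).+1 (sval y) (code x') ->
    sval y (0, j) = `[< C j x' >] by move=> /(_ (0, j) (ltnSn _)).
rewrite [RHS]/code /=; have [Cx|nCx] := pselect (C j x).
  have [V Vx V0] : exists2 V, nbhs x V & V `&` (S `\` C j) = set0.
    by apply: sep => h; apply: nC; split => //; exact: subset_closure.
  have [x' [Sx' /sub -> Vx' _]] := near_base_pt (pickle ((0, j) : index)).+1 Vx ltr01.
  apply/asboolP/asboolP => // _; apply: contrapT => nCx'.
  by have : (V `&` (S `\` C j)) x' by []; rewrite V0.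
have [V Vx V0] : exists2 V, nbhs x V & V `&` C j = set0.
  apply: sep => h; apply: nC; split => //; apply: subset_closure; split => //.
  exact: regular_base_pt.
have [x' [Sx' /sub -> Vx' _]] := near_base_pt (pickle ((0, j) : index)).+1 Vx ltr01.
apply/asboolP/asboolP => // Cx'.
by have : (V `&` C j) x' by []; rewrite V0.
Qed.

End over_regular_point.

Lemma regular_pt_shift y : regular_pt (base_pt y) -> regular_pt (base_pt (shift y)).
Proof. by rewrite base_pt_shift; exact: regular_pt_flow. Qed.

Lemma regular_pt_shift_inv y : regular_pt (base_pt y) -> regular_pt (base_pt (shift_inv y)).
Proof.
move=> Ey; have := base_pt_shift (shift_inv y); rewrite shift_invK => e.
have -> : base_pt (shift_inv y) = phi (- roof (shift_inv y)) (base_pt y).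
  by rewrite e flowK.
exact: regular_pt_flow.
Qed.

Lemma regular_code y : regular_pt (base_pt y) -> sval y = code (base_pt y).
Proof.
move=> Ey; apply/funext => -[n j].
(* Every other row is row 0 of an iterated shift of [y], whose base point is the corresponding
   return of [base_pt y]. *)
elim/int_rect: n y Ey => [|n IH|n IH] y Ey; first exact: regular_code0.
  have := IH _ (regular_pt_shift Ey); rewrite regular_base_pt_shift// code_return_map.
    by rewrite -addn1 PoszD.
  exact: regular_base_pt.
have Ey' := regular_pt_shift_inv Ey.
have := IH _ Ey'.
have -> : base_pt (shift_inv y) = return_map_inv (base_pt y).
  have := regular_base_pt_shift Ey'; rewrite shift_invK => ->.
  by rewrite return_mapK//; exact: regular_base_pt.
rewrite code_return_map_inv; last exact: regular_base_pt.
by rewrite /= /shift_code /= -opprD -PoszD addn1.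
Qed.

Lemma coding_extension : exists (Y : metricType R) (T : Y -> Y) (r : Y -> R)
    (Psi : R -> suspension T r -> suspension T r) (pi : suspension T r -> X),
  [/\ compact [set: Y], zero_dimensional Y, homeomorphism T, continuous r
    & forall y, 0 < r y] /\
  [/\ is_suspension_flow Psi, topological_extension Psi phi pi
    & set_inj (pi @^-1` [set x | regular_pt x]) pi].
Proof.
pose g (v : Y * R) := phi v.2 (base_pt v.1).
have cg : continuous g.
  exact: continuous_compose (continuous_pair continuous_snd
    (continuous_compose continuous_fst base_pt_continuous)) (flow_continuous2 phiP).
have gshear (v : Y * R) : g (shear shift roof v) = g v.
  by rewrite /g /= base_pt_shift -flowD// subrK.
have [pi cpi piE] := lift_unroll_exists shiftK shift_invK a0 roof_ge cg gshear.
pose Psi := suspension_flow shift_invK a0 roof_ge.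
exists Y, shift, roof, Psi, pi; split; split.
- exact: codes_compact.
- exact: code_space_zero_dimensional.
- split; first exact: shift_continuous.
  by exists shift_inv; split; [exact: shift_inv_continuous|exact: shiftK|exact: shift_invK].
- exact: roof_continuous.
- by move=> y; exact: lt_le_trans (roof_ge y).
- exact: (suspension_flow_is_flow shift_continuous shift_inv_continuous
    shiftK shift_invK roof_continuous a0 roof_ge).
- split => //.
    (* [unroll] accepts any height, so the previous hit of [S] together with the time elapsed since
       then is a preimage of [x]. *)
    apply/seteqP; split => // x _; have [_ Sx _] := rho'P x.
    exists (unroll shift_invK a0 roof_ge (code_pt Sx, rho' x)) => //.
    by rewrite piE /g /= /base_pt cluster_data_code /= flowNK.
  move=> t z; have [p ->] := unroll_surj shiftK shift_invK a0 roof_ge z.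
  rewrite /Psi (suspension_flow_unroll shiftK) !piE /g /shift_time /=.
  by rewrite addrC flowD.
move=> z z' /set_mem /= Ez _.
have [y [s [s0 sr ze]]] := unroll_surj_lt shiftK shift_invK a0 roof_ge z.
have [y' [s' [s'0 s'r z'e]]] := unroll_surj_lt shiftK shift_invK a0 roof_ge z'.
rewrite ze z'e !piE /g /= => zz'; rewrite ze piE /g /= in Ez.
have Ey : regular_pt (base_pt y).
  by rewrite -(flowK phiP s (base_pt y)); exact: regular_pt_flow.
have Ey' : regular_pt (base_pt y').
  by rewrite -(flowK phiP s' (base_pt y')) -zz'; exact: regular_pt_flow.
(* If [t' < t], then [base_pt v] would be a hit on the orbit of [base_pt u] before its first return.
   So the heights agree, hence the base points, hence the codes. *)
have key u v t t' : 0 <= t' -> t' <= t -> t < roof u -> regular_pt (base_pt u) ->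
    regular_pt (base_pt v) -> phi t (base_pt u) = phi t' (base_pt v) -> u = v /\ t = t'.
  move=> t'0 tt' tu Eu Ev uv.
  have e : base_pt v = phi (t - t') (base_pt u).
    by rewrite addrC flowD// uv flowK.
  have t_t' : t = t'.
    apply/eqP; rewrite -subr_eq0; apply/negPn/negP => nz.
    have [_ _ /(_ (t - t'))] := rhoP (base_pt u).
    rewrite lt_neqAle eq_sym nz subr_ge0 tt' -e => /(_ isT (regular_base_pt Ev)).
    by rewrite -regular_roof//; lra.
  split => //; apply: code_space_inj.
  by rewrite !regular_code// e t_t' subrr flow0.
have [ss'|/ltW ss'] := leP s' s.
  by have [-> ->] := key y y' s s' s'0 ss' sr Ey Ey' zz'.
by have [-> ->] := key y' y s' s s0 ss' s'r Ey' Ey (esym zz').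
Qed.

End coding.

(** * Null sets *)

Section borel_and_null_sets.
Context {R : realType} {X : topologicalType} (phi : R -> X -> X).
Implicit Types (A B D S : set X).

Lemma borel_open A : open A -> borel_set A.
Proof. by move=> oA; exact: sub_sigma_algebra. Qed.

Lemma borelC A : borel_set A -> borel_set (~` A).
Proof. by rewrite /borel_set => /sigma_algebraCD; rewrite setTD. Qed.

Lemma borel_closed A : closed A -> borel_set A.
Proof. by move=> cA; rewrite -[A]setCK; apply: borelC; apply: borel_open; exact: closed_openC. Qed.

Lemma borel_bigcup (F : nat -> set X) :
  (forall n, borel_set (F n)) -> borel_set (\bigcup_n F n).
Proof. exact: sigma_algebra_bigcup. Qed.

Lemma borel_preimage (f : X -> X) A :
  continuous f -> borel_set A -> borel_set (f @^-1` A).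
Proof.
move=> cf; apply: (@smallest_sub _ _ _ [set B | borel_set (f @^-1` B)]).
  split => [|B BB|F FB] /=.
  - by rewrite preimage_set0; exact: sigma_algebra0.
  - by rewrite setTD preimage_setC; exact: borelC.
  - by rewrite preimage_bigcup; exact: borel_bigcup.
by move=> B oB /=; apply: borel_open; move/continuousP: cf; exact.
Qed.

Lemma null_setS A B : A `<=` B -> null_set phi B -> null_set phi A.
Proof.
move=> AB nB x0 mu imu; have [M [mM M0 BM]] := nB x0 mu imu.
by exists M; split => //; exact: subset_trans BM.
Qed.

Lemma null_setU A B : null_set phi A -> null_set phi B -> null_set phi (A `|` B).
Proof.
by move=> nA nB x0 mu imu; exact: negligibleU (nA x0 mu imu) (nB x0 mu imu).
Qed.

Lemma null_bigcup (F : nat -> set X) :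
  (forall n, null_set phi (F n)) -> null_set phi (\bigcup_n F n).
Proof. by move=> nF x0 mu imu; apply: negligible_bigcup => n; exact: nF. Qed.

Lemma null_set0 : null_set phi set0.
Proof. by move=> x0 mu _; exact: negligible_set0. Qed.

Context (phiP : is_flow phi).

Lemma null_preimage t A : null_set phi A -> null_set phi (phi t @^-1` A).
Proof.
move=> nA x0 mu imu; have [B [mB B0 AB]] := nA x0 mu imu.
exists (phi t @^-1` B); split; last by move=> x /AB.
- by apply: borel_preimage => //; exact: flow_continuous.
- by rewrite imu.
Qed.

Definition orbit_null D := null_set phi (flow_image phi setT D).

Lemma orbit_nullS D D' : D `<=` D' -> orbit_null D' -> orbit_null D.
Proof.
move=> DD'; apply: null_setS => _ [t _ [x Dx <-]].
by exists t => //; exists x => //; exact: DD'.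
Qed.

Lemma orbit_nullU D D' : orbit_null D -> orbit_null D' -> orbit_null (D `|` D').
Proof.
move=> nD nD'; apply: null_setS (null_setU nD nD') => _ [t _ [x [Dx|D'x] <-]].
  by left; exists t => //; exists x.
by right; exists t => //; exists x.
Qed.

Lemma orbit_null0 : orbit_null set0.
Proof. by apply: null_setS null_set0 => z [t _ [x]]. Qed.

Lemma orbit_null_shift s D : orbit_null D -> orbit_null (phi s @^-1` D).
Proof.
apply: null_setS => _ [t _ [x Dx <-]]; exists (t - s) => //; exists (phi s x) => //.
by rewrite -flowD// subrK.
Qed.

(** Countably many translates of the box, by multiples of [e], cover the orbit of [D], and
    translates of a null set are null because the measures are invariant. *)
Lemma orbit_null_of_box e D :
  0 < e -> null_set phi (flow_image phi `[- e, e] D) -> orbit_null D.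
Proof.
move=> e0 nD; set F := flow_image phi `[- e, e] D in nD.
have : null_set phi (\bigcup_n (phi (- (n%:R * e)) @^-1` F `|` phi (n%:R * e) @^-1` F)).
  by apply: null_bigcup => n; apply: null_setU; exact: null_preimage.
apply: null_setS => _ [t _ [x Dx <-]]; pose n := Num.truncn (`|t| / e).
have te : 0 <= `|t| / e by rewrite divr_ge0// ltW.
have ne : n%:R * e <= `|t| by rewrite -ler_pdivlMr// truncn_le.
have en : `|t| < n%:R * e + e.
  by rewrite -[X in _ + X]mul1r -mulrDl natr1 -ltr_pdivrMr// truncnS_gt.
exists n => //; have [t0|t0] := leP 0 t.
  left; exists (t - n%:R * e); last by exists x => //; rewrite addrC flowD.
  rewrite ger0_norm// in ne en; rewrite /= in_itv /=; apply/andP; split; lra.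
right; exists (t + n%:R * e); last by exists x => //; rewrite addrC flowD.
rewrite ltr0_norm// in ne en; rewrite /= in_itv /=; apply/andP; split; lra.
Qed.

Lemma flow_image_closed e D : hausdorff_space X -> compact D ->
  closed (flow_image phi `[- e, e] D).
Proof.
move=> hX cD; apply: compact_closed => //.
have -> : flow_image phi `[- e, e] D =
    (fun p : R * X => phi p.1 p.2) @` (`[- e, e] `*` D).
  apply/seteqP; split=> [_ [t It [x Sx <-]]|_ [[t x] [/= It Sx] <-]].
    by exists (t, x).
  by exists t => //; exists x.
apply: continuous_compact; first exact/continuous_subspaceT/flow_continuous2.
by apply: compact_setX => //; exact: segment_compact.
Qed.

Lemma orbit_borel D : hausdorff_space X -> compact D ->
  borel_set (flow_image phi setT D).
Proof.
move=> hX cD; rewrite (_ : flow_image _ _ _ = \bigcup_n flow_image phi `[- n%:R, n%:R] D).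
  by apply: borel_bigcup => n; apply: borel_closed; exact: flow_image_closed.
apply/seteqP; split => [_ [t _ [x Dx <-]]|_ [n _ [t _ [x Dx <-]]]]; last first.
  by exists t => //; exists x.
exists (Num.truncn `|t|).+1 => //; exists t; last by exists x.
by rewrite /= in_itv /= -ler_norml ltW// truncnS_gt.
Qed.

End borel_and_null_sets.

(* A point of [closure S] interior to every flow box of [S] lies in [S] because
   hits of [S] are [a]-separated; so the bad orbits form a Borel set. *)
Lemma coded_extension {R : realType} {X : metricType R} (phi : R -> X -> X)
    (S : set X) (a b : R) (C : nat * nat -> set X) (N : nat -> nat) :
  compact [set: X] -> is_flow phi -> 0 < a ->
  (forall x t, S x -> S (phi t x) -> `|t| <= a -> t = 0) ->
  (forall x, exists2 t, 0 < t <= b & S (phi t x)) ->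
  (forall x, exists2 t, 0 < t <= b & S (phi (- t) x)) ->
  (forall x t, phi t x = x -> `|t| <= b -> t = 0) ->
  orbit_null phi (closure S `\` flow_inner phi S) ->
  (forall k x, S x -> exists2 i, (i < N k)%N & C (k, i) x) ->
  (forall k i x y, C (k, i) x -> C (k, i) y -> ball x k.+1%:R^-1 y) ->
  (forall j, orbit_null phi (closure (C j) `&` closure (S `\` C j))) ->
  exists (Y : metricType R) (T : Y -> Y) (r : Y -> R)
    (Psi : R -> suspension T r -> suspension T r) (pi : suspension T r -> X),
  [/\ compact [set: Y], zero_dimensional Y, homeomorphism T, continuous r
    & forall y, 0 < r y] /\
  [/\ is_suspension_flow Psi, topological_extension Psi phi pi
    & strongly_isomorphic phi pi].
Proof.
move=> cX phiP a0 gap hit hit' period nS cov small nC.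
have hX := @metric_hausdorff R X.
have clc (D : set X) : closed D -> compact D.
  by move=> cD; exact: subclosed_compact cD cX _.
have [rho rhoP] := next_hit_exists phiP a0 gap hit.
pose psi t := phi (- t).
have psiP : is_flow psi.
  split => [x|s t x|]; rewrite /psi.
  - by rewrite oppr0 flow0.
  - by rewrite opprD flowD.
  - have c : continuous (fun p : R * X => (- p.1, p.2)).
      apply: continuous_pair; last exact: continuous_snd.
      by move=> p; apply: cvgN; exact: continuous_fst.
    exact: continuous_compose c (flow_continuous2 phiP).
have gap' x t : S x -> S (psi t x) -> `|t| <= a -> t = 0.
  move=> Sx Sp ta; apply/eqP; rewrite -oppr_eq0; apply/eqP.
  by apply: gap Sx Sp _; rewrite normrN.
have [rho' rho'P] := next_hit_exists psiP a0 gap' hit'.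
have [Y [T [r [Psi [pi [h1 [h2 h3 inj]]]]]]] :=
  coding_extension cX phiP a0 gap rhoP rho'P period cov small.
exists Y, T, r, Psi, pi; split => //; split => //.
(* Countably many scales replace all [e] in [flow_inner], and leaving out membership in [S] makes
   each [D k] closed. *)
pose D k := closure S `\` interior (flow_image phi `[- k.+1%:R^-1, k.+1%:R^-1] S).
pose D' k i := closure (C (k, i)) `&` closure (S `\` C (k, i)).
have cD k : closed (D k).
  by apply: closedI; [exact: closed_closure|exact/open_closedC/open_interior].
have cD' k i : closed (D' k i) by apply: closedI; exact: closed_closure.
pose bad := \bigcup_k flow_image phi setT (D k) `|`
  \bigcup_k \bigcup_i flow_image phi setT (D' k i).
have bad_flow s x D0 : D0 (phi s x) -> flow_image phi setT D0 x.
  by move=> Dx; exists (- s) => //; exists (phi s x) => //; rewrite flowK.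
have good_regular : ~` bad `<=` [set x | regular_pt phi S C x].
  move=> x nb; split => [s cx|s [k i] h]; last first.
    by apply: nb; right; exists k => //; exists i => //; exact: bad_flow h.
  have int k : interior (flow_image phi `[- k.+1%:R^-1, k.+1%:R^-1] S) (phi s x).
    by apply: contrapT => h; apply: nb; left; exists k => //; exact: (bad_flow s).
  set p := phi s x in cx int *.
  have small_k (e : R) : 0 < e -> exists k : nat, k.+1%:R^-1 <= e.
    move=> e0; exists (Num.truncn e^-1).
    by rewrite invf_ple ?posrE// ltW// truncnS_gt.
  split; last first.
    move=> e /small_k[k ke]; apply: filterS (int k) => _ [u /= + [w Sw <-]].
    rewrite in_itv /= => /andP[u1 u2]; exists u; last by exists w.
    set i := k.+1%:R^-1 in ke u1 u2.
    by rewrite /= in_itv /=; apply/andP; split; lra.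
  have a20 : 0 < a / 2 by rewrite divr_gt0.
  have [k ka] := small_k _ a20.
  (* Two hits at times within [a / 2] of [p] are at most [a] apart and so coincide; as the second
     can be taken arbitrarily close to [p], the first occurs at time 0. *)
  have [u /= + [w Sw pw]] := interior_subset (int k).
  rewrite in_itv /= => /andP[u1 u2].
  suff u0 : u = 0 by rewrite -pw u0 flow0.
  apply/eqP; rewrite -normr_le0; apply/ler_addgt0Pl => e e0; rewrite addr0.
  have em : 0 < Num.min e (a / 2) by rewrite lt_min e0.
  have [m me] := small_k _ em.
  have [v /= + [w' Sw' pw']] := interior_subset (int m).
  rewrite in_itv /= => /andP[v1 v2].
  have [me1 me2] : m.+1%:R^-1 <= e /\ m.+1%:R^-1 <= a / 2 :> R.
    by move: me; rewrite le_min => /andP[].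
  have uv : u - v = 0.
    apply: (gap w) => //.
      by rewrite addrC flowD// pw -pw' flowK.
    set i := k.+1%:R^-1 in ka u1 u2; set j := m.+1%:R^-1 in me1 me2 v1 v2.
    by rewrite ler_norml; apply/andP; split; lra.
  rewrite (_ : u = v); last by lra.
  set j := m.+1%:R^-1 in me1 v1 v2.
  by rewrite ler_norml; apply/andP; split; lra.
exists (~` bad); split; last first.
  move=> z z' zE z'E; apply: inj; apply: mem_set; apply: good_regular;
    [exact: set_mem zE|exact: set_mem z'E].
split; last first.
  rewrite setCK; apply: null_setU.
    apply: null_bigcup => k; apply: orbit_nullS nS => x [cx nx]; split => //.
    by move=> [_ h]; apply: nx; apply: h.
  by apply: null_bigcup => k; apply: null_bigcup => i; exact: nC.
apply: borelC; rewrite /bad -bigcup2E; apply: borel_bigcup => -[|[|n]] /=.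
- by apply: borel_bigcup => k; apply: orbit_borel => //; exact: clc.
- apply: borel_bigcup => k; apply: borel_bigcup => i.
  by apply: orbit_borel => //; exact: clc.
- apply: borel_closed; exact: closed0.
Qed.

(** * Local sections *)

(** Compactness as near covering, for the filter of lists directed by inclusion. [List.In] is used
    since [A] carries no equality test. *)
Lemma compact_list_cover {X : topologicalType} {A : Type} (K : set X)
    (Q : A -> Prop) (U : A -> set X) :
  compact K -> (forall p, K p -> exists2 a, Q a & nbhs p (U a)) ->
  exists2 l : seq A, (forall a, List.In a l -> Q a) &
    forall p, K p -> exists2 a, List.In a l & U a p.
Proof.
move=> /compact_near_coveringP cK h.
pose F : set_system (seq A) := fun P => exists2 l0, (forall a, List.In a l0 -> Q a) &
  forall l, (forall a, List.In a l0 -> List.In a l) -> P l.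
have FF : Filter F.
  split; first by exists [::].
  - move=> P P' [l Ql lP] [l' Ql' l'P']; exists (l ++ l').
      by move=> a /List.in_app_iff[/Ql|/Ql'].
    move=> m hm; split.
      by apply: lP => a al; apply/hm/List.in_app_iff; left.
    by apply: l'P' => a al; apply/hm/List.in_app_iff; right.
  - by move=> P P' PP' [l Ql lP]; exists l => // m /lP/PP'.
have [x Kx|l Ql lP] := cK _ F (fun l x => exists2 a, List.In a l & U a x) FF.
  have [a Qa Ua] := h x Kx.
  exists (U a, [set l | List.In a l]); last by move=> [y l] [/= Uy al]; exists a.
  split => //; exists [:: a] => [b /= [<-//|//]|l]; by apply; left.
by exists l => // p Kp; exact: lP.
Qed.

Lemma exists_between_notin {R : realType} (L : seq R) (l r : R) :
  l < r -> exists2 s, l < s < r & s \notin L.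
Proof.
elim: L l r => [|x L IH] l r lr.
  by exists ((l + r) / 2); rewrite // !midf_lt.
have [xm|mx] := ltP x ((l + r) / 2).
  have [|s /andP[s1 s2] sL] := IH ((l + r) / 2) r; first by rewrite midf_lt.
  exists s; first by rewrite s2 andbT (lt_trans _ s1)// midf_lt.
  by rewrite inE negb_or sL andbT gt_eqF// (lt_trans xm).
have [|s /andP[s1 s2] sL] := IH l ((l + r) / 2); first by rewrite midf_lt.
exists s; first by rewrite s1 (lt_trans s2)// midf_lt.
by rewrite inE negb_or sL andbT lt_eqF// (lt_le_trans s2).
Qed.

Section sections.
Context {R : realType} {X : metricType R} (phi : R -> X -> X).
Context (cX : compact [set: X]) (phiP : is_flow phi).
Implicit Types (A B G K S V : set X) (x y p : X) (e eta : R).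

Definition transverse e B := forall x t, B x -> B (phi t x) -> `|t| <= e -> t = 0.

Definition extendable B := exists2 e, 0 < e & transverse e (closure B).

Lemma transverse_sub e A B : A `<=` B -> transverse e B -> transverse e A.
Proof. by move=> AB tB x t /AB Bx /AB; exact: tB. Qed.

Lemma extendable_sub A B : A `<=` B -> extendable B -> extendable A.
Proof. by move=> AB [e e0 tB]; exists e => //; apply: transverse_sub tB; exact: closureS. Qed.

Lemma cross_sectionP eta S :
  cross_section phi eta S <-> 0 < eta /\ transverse (eta *+ 2) S.
Proof.
rewrite mulr2n; split=> [[eta0 inj]|[eta0 tS]]; split => //.
  move=> x t Sx St; rewrite ler_norml => /andP[t1 t2].
  (* A return after time [t] is a collision in the flow box, at times [t / 2] and [- (t / 2)]; hence
     the factor 2. *)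
  have /= h := inj (x, t / 2) (phi t x, - (t / 2)).
  suff [_ ?] : (x, t / 2) = (phi t x, - (t / 2)) by lra.
  apply: h; rewrite ?inE /=.
  - by split => //=; rewrite in_itv /=; apply/andP; split; lra.
  - by split => //=; rewrite in_itv /=; apply/andP; split; lra.
  - by rewrite -flowD//; congr phi; lra.
move=> [x s] [y t] /set_mem[/= Sx +] /set_mem[/= Sy].
rewrite !in_itv /= => /andP[s1 s2] /andP[t1 t2] xy.
have yE : y = phi (s - t) x by rewrite addrC flowD// xy flowK.
have st : s - t = 0.
  by apply: (tS x) => //; rewrite -?yE// ler_norml; apply/andP; split; lra.
by rewrite yE st flow0//; congr pair; lra.
Qed.

Lemma extendableP B : extendable B <-> exists eta, weakly_extendable phi eta B.
Proof.
split=> [[e e0 tB]|[eta [_ /cross_sectionP[eta0 tB]]]]; last first.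
  by exists (eta *+ 2) => //; rewrite pmulrn_rgt0.
exists (e / 2); have e2 : e / 2 *+ 2 = e by rewrite mulr2n -splitr.
split; apply/cross_sectionP; rewrite e2 divr_gt0//; split => //.
by apply: transverse_sub tB; exact: subset_closure.
Qed.

Lemma box_le e eta S : e <= eta ->
  flow_image phi `[- e, e] S `<=` flow_image phi `[- eta, eta] S.
Proof.
move=> ee _ [t /= + [x Sx <-]]; rewrite in_itv /= => /andP[t1 t2].
by exists t; [rewrite /= in_itv /=; apply/andP; split; lra|exists x].
Qed.

Lemma flow_innerE eta S : weakly_extendable phi eta S ->
  flow_interior phi eta S = [set x | flow_inner phi S x].
Proof.
move=> wS; have eta0 : 0 < eta by case: wS => -[].
apply/seteqP; split => x; last by move=> [Sx /(_ _ eta0)].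
move=> ix; split; first by case: ix.
move=> e e0; pose z := Num.min e eta.
have z0 : 0 < z <= eta by rewrite lt_min e0 eta0 ge_min lexx orbT.
rewrite -(flow_interior_indep cX phiP wS z0) in ix.
by case: ix => ix _; apply: filterS ix; apply: box_le; rewrite ge_min lexx.
Qed.

Lemma flow_inner_sub A B x : A `<=` B -> flow_inner phi A x -> flow_inner phi B x.
Proof.
move=> AB [Ax h]; split => [|e e0]; first exact: AB.
apply: filterS (h e e0) => _ [t te [y Ay <-]].
by exists t => //; exists y => //; exact: AB.
Qed.

Lemma flow_inner_local B V x :
  flow_inner phi B x -> nbhs x V -> flow_inner phi (B `&` V) x.
Proof.
move=> [Bx h] Vx; split=> [|e e0]; first by split => //; exact: nbhs_singleton.
have [[W T] [/= Wx /nbhs_ballP[d /= d0 dT]] WT] := near_flow phiP Vx.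
have m0 : 0 < Num.min e (d / 2) by rewrite lt_min e0 divr_gt0.
apply: filterS (filterI Wx (h _ m0)) => _ [/[swap] -[t /= + [y By <-]] Wy].
have m1 : Num.min e (d / 2) <= e by rewrite ge_min lexx.
have m2 : Num.min e (d / 2) <= d / 2 by rewrite ge_min lexx orbT.
rewrite in_itv /= => /andP[t1 t2].
exists t; first by rewrite /= in_itv /=; apply/andP; split; lra.
exists y => //; split => //; rewrite -[y](flowK phiP t).
apply: (WT (phi t y, - t)); split => //=; apply: dT.
rewrite /ball /= sub0r opprK ltr_norml; apply/andP; split; lra.
Qed.

(** A point of [B] near [x] is reached from a point of [G] in a time too short for [B] to be met
    twice, so that time is 0. Thus a flow interior point of [G] is interior relative to [B]. *)
Lemma near_flow_inner B G x : extendable B -> G `<=` B -> flow_inner phi G x ->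
  \forall y \near x, B y -> G y.
Proof.
move=> [e e0 tB] GB [_ /(_ e e0)]; apply: filterS => _ [t /= + [y Gy <-]] Bt.
rewrite in_itv /= -ler_norml => te.
have -> // : phi t y = y.
have -> : t = 0; last by rewrite flow0.
by apply: (tB y) => //; apply: subset_closure => //; exact: GB.
Qed.

Lemma near_closure_flow_inner B x : extendable B -> flow_inner phi B x ->
  \forall y \near x, closure B y -> flow_inner phi B y.
Proof.
move=> /[dup] extB /extendableP[eta wB] ix.
have := ix; rewrite -[flow_inner _ _ _]/([set x | flow_inner phi B x] x).
rewrite -(flow_innerE wB) => -[+ _] => /nbhs_interior; apply: filterS => y iy cBy.
suff By : B y.
  by rewrite -[flow_inner _ _ _]/([set x | flow_inner phi B x] y) -(flow_innerE wB).
case: wB => _ /cross_sectionP[eta0 tB].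
have [t /= + [z Bz zy]] := interior_subset iy.
rewrite in_itv /= -ler_norml => te.
suff t0 : t = 0 by rewrite -zy t0 flow0.
apply: (tB z); [exact: subset_closure|by rewrite zy|].
by rewrite (le_trans te)// mulr2n lerDl ltW.
Qed.

Lemma closure_shift s A : closure (phi s @^-1` A) `<=` phi s @^-1` closure A.
Proof.
move=> x cx V Vx; have [y [Ay Vy]] := cx _ (flow_continuous phiP Vx).
by exists (phi s y).
Qed.

Lemma flow_inner_shift s A x :
  flow_inner phi A (phi s x) -> flow_inner phi (phi s @^-1` A) x.
Proof.
move=> [Ax h]; split => // e e0.
have nx : nbhs x (phi s @^-1` flow_image phi `[- e, e] A).
  by apply: (flow_continuous phiP); exact: h.
apply: filterS nx => y /= [t te [z Az zy]].
exists t => //; exists (phi (- s) z); first by rewrite /= flowNK.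
by rewrite -flowD// addrC flowD// zy flowK.
Qed.

Lemma extendable_shift s B : extendable B -> extendable (phi s @^-1` B).
Proof.
move=> [e e0 tB]; exists e => // x t /closure_shift /= Bx /closure_shift /= + te.
by rewrite -flowD// addrC flowD// => Bt; exact: tB Bx Bt te.
Qed.

Definition null_boundary S := orbit_null phi (closure S `\` flow_inner phi S).

Lemma null_boundary_shift s S : null_boundary S -> null_boundary (phi s @^-1` S).
Proof.
move=> /(orbit_null_shift phiP s); apply: orbit_nullS => x [/closure_shift cx nx].
by split => // ix; apply: nx; exact: flow_inner_shift.
Qed.

Lemma null_boundaryU S S' : null_boundary S -> null_boundary S' -> null_boundary (S `|` S').
Proof.
move=> nS nS'; apply: orbit_nullS (orbit_nullU nS nS') => x [].
rewrite closureU => -[cx|cx] nx; [left|right]; split => // ix; apply: nx.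
  exact: flow_inner_sub (@subsetUl _ S S') ix.
exact: flow_inner_sub (@subsetUr _ S S') ix.
Qed.

Lemma null_boundary_exists B x V : small_flow_boundary_property phi ->
  extendable B -> flow_inner phi B x -> nbhs x V ->
  exists G, [/\ G `<=` B, G `<=` V, flow_inner phi G x & null_boundary G].
Proof.
move=> sfb extB ix Vx.
have ixV := flow_inner_local ix Vx.
have /extendableP[eta wBV] : extendable (B `&` V) by apply: extendable_sub extB => y [].
have [|G [GBV wG iG nG]] := sfb x eta _ wBV; first by rewrite flow_innerE.
have eta0 : 0 < eta by case: wG => -[].
exists G; split; [by move=> y /GBV[]|by move=> y /GBV[]| |].
  by move: iG; rewrite flow_innerE.
apply: (orbit_null_of_box phiP eta0).
rewrite (_ : closure G `\` _ = flow_boundary phi eta G)//.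
by rewrite /flow_boundary flow_innerE.
Qed.

Lemma closed_nbhs_exists x V : nbhs x V -> exists2 U, nbhs x U & closure U `<=` V.
Proof.
move=> Vx; have [U Ux UV] := @uniform_regular X x V Vx.
by exists U.
Qed.

End sections.

(* Bebutov's local sections without integrals: for the maximum [theta y] over
   [|s| <= L] of [- M d(x, phi_s y) - s], a shift by [h] of [y] shifts the
   maximizer, so [theta (phi_h y) = theta y + h] as long as no maximizer gets near
   the ends [s = - L, L]; this holds near [x] once [M] is large. *)
Section bebutov.
Context {R : realType} {X : metricType R} (phi : R -> X -> X) (phiP : is_flow phi).
Context (x : X) (L M : R) (L0 : 0 < L).
Context (ML : L + 1 < M * mdist x (phi L x)) (MNL : L + 1 < M * mdist x (phi (- L) x)).

Let F (y : X) (s : R) : R := - (M * mdist x (phi s y)) - s.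

Lemma mdist_continuous_right : continuous (fun y : X => mdist x y).
Proof.
move=> y; apply/cvgrPdist_lt => e e0.
apply: filterS (nbhsx_ballx y e e0) => z; rewrite ballEmdist /= => yz.
have h1 := metric_triangle x y z; have h2 := metric_triangle x z y.
rewrite (metric_sym z y) in h2.
by rewrite ltr_norml; apply/andP; split; lra.
Qed.

Lemma penalty_continuous : continuous (fun p : X * R => F p.1 p.2).
Proof.
apply: continuous_sub; last exact: continuous_snd.
have c : continuous (fun p : X * R => mdist x (phi p.2 p.1)).
  exact: continuous_compose (continuous_compose (continuous_pair continuous_snd continuous_fst)
    (flow_continuous2 phiP)) mdist_continuous_right.
by move=> p; apply: cvgN; apply: cvgMr; exact: c.
Qed.

Lemma penalty_shift y s h : F (phi h y) s = F y (s + h) + h.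
Proof. by rewrite /F -flowD// opprD addrA subrK. Qed.

Lemma penalty_max_exists y : exists m : R, (forall s, - L <= s <= L -> F y s <= m) /\
  exists2 s, - L <= s <= L & m = F y s.
Proof.
have L1 : - L <= L by rewrite -subr_ge0 opprK addr_ge0// ltW.
have cF : {within `[- L, L], continuous (F y)}.
  apply: continuous_subspaceT.
  have c : continuous (fun s : R => (y, s)).
    by apply: continuous_pair => s; [exact: cvg_cst|exact: cvg_id].
  exact: continuous_compose c penalty_continuous.
have [s sL smax] := EVT_max L1 cF.
rewrite in_itv in sL; exists (F y s); split; last by exists s.
by move=> t tL; apply: smax; rewrite in_itv.
Qed.

Definition penalty_max y := projT1 (cid (penalty_max_exists y)).

Lemma penalty_max_ge y s : - L <= s <= L -> F y s <= penalty_max y.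
Proof. by rewrite /penalty_max; case: cid => m /= [h _]; exact: h. Qed.

Lemma penalty_max_attained y : exists2 s, - L <= s <= L & penalty_max y = F y s.
Proof. by rewrite /penalty_max; case: cid => m /= []. Qed.

Lemma penalty_max_continuous : continuous penalty_max.
Proof.
move=> y; apply/cvgrPdist_le => e e0.
have /compact_near_coveringP cov := @segment_compact R (- L) L.
have near_s : \forall z \near y, `[- L, L]%classic `<=` (fun s => `|F y s - F z s| <= e).
  apply: (cov _ (nbhs y) (fun z s => `|F y s - F z s| <= e) (nbhs_filter y)) => s _.
  have e20 : 0 < e / 2 by rewrite divr_gt0.
  have /cvgrPdist_lt/(_ _ e20) [[A B] [/= Ay Bs] AB] := @penalty_continuous (y, s).
  exists (B, A); first by split.
  move=> [t z] [/= Bt Az].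
  have /= h1 := AB (z, t) (conj Az Bt).
  have /= h2 := AB (y, t) (conj (nbhs_singleton Ay) Bt).
  move: h1 h2; rewrite !ltr_norml => /andP[? ?] /andP[? ?].
  by rewrite ler_norml; apply/andP; split; lra.
apply: filterS near_s => z h.
have [s sL sE] := penalty_max_attained y; have [t tL tE] := penalty_max_attained z.
have := h s sL; have := h t tL.
have := penalty_max_ge y tL; have := penalty_max_ge z sL.
rewrite !ler_norml sE tE => ? ? /andP[? ?] /andP[? ?]; apply/andP; split; lra.
Qed.

Lemma penalty_max_shift : exists2 d, 0 < d &
  \forall y \near x, forall h, `|h| <= d -> penalty_max (phi h y) = penalty_max y + h.
Proof.
have [L0' ML' MNL'] := And3 L0 ML MNL.
have F0 : F x 0 = 0 by rewrite /F flow0// mdistxx mulr0 subr0 oppr0.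
(* [ML] and [MNL] push [F x] below [- 1] at both ends while [F x 0 = 0]; the level [- (1 / 2)] lies
   strictly between, which leaves room to vary [x]. *)
have FL : F x L < - (1 / 2) by rewrite /F; lra.
have FNL : F x (- L) < - (1 / 2) by rewrite /F; lra.
have ends s : F x s < - (1 / 2) -> exists2 d, 0 < d &
    \forall y \near x, forall t, `|t - s| <= d -> F y t < - (1 / 2).
  move=> h; have cN : continuous (fun p : X * R => - F p.1 p.2).
    by move=> p; apply: cvgN; exact: penalty_continuous.
  have h' : 1 / 2 < - F (x, s).1 (x, s).2 by rewrite ltrNr.
  have [[A B] [/= Ax /nbhs_ballP[e /= e0 eB]] AB] := near_continuous_gt cN h'.
  exists (e / 2); first by rewrite divr_gt0.
  apply: filterS Ax => y Ay t ts; rewrite -ltrNr; apply: (AB (y, t)); split => //=.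
  apply: eB; rewrite /ball /= distrC; apply: le_lt_trans ts _; lra.
have [d1 d10 n1] := ends _ FL; have [d2 d20 n2] := ends _ FNL.
have n3 : \forall y \near x, - (1 / 2) < F y 0.
  have c : continuous (fun y => F y 0).
    have c : continuous (fun y : X => (y, 0 : R)).
      by apply: continuous_pair => y; [exact: cvg_id|exact: cvg_cst].
    exact: continuous_compose c penalty_continuous.
  by apply: (near_continuous_gt c); rewrite F0; lra.
pose d := Num.min (Num.min d1 d2) L.
have [dd1 dd2 dL] : [/\ d <= d1, d <= d2 & d <= L].
  by rewrite /d !ge_min !lexx !orbT.
have d0 : 0 < d by rewrite /d !lt_min d10 d20.
exists d => //; apply: filterS (filterI n1 (filterI n2 n3)) => y [m1 [m2 m3]] h.
rewrite ler_norml => /andP[h1 h2].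
have y0 : F y 0 <= penalty_max y by apply: penalty_max_ge; apply/andP; split; lra.
have inner s : - (1 / 2) < F y s -> - L - d <= s <= L + d -> - L + d < s < L - d.
  move=> ys /andP[s1 s2]; apply/andP; split; rewrite ltNge; apply/negP => sL.
    have : F y s < - (1 / 2) by apply: m2; rewrite ler_norml; apply/andP; split; lra.
    lra.
  have : F y s < - (1 / 2) by apply: m1; rewrite ler_norml; apply/andP; split; lra.
  lra.
apply/eqP; rewrite eq_le; apply/andP; split.
  have [s /andP[s1 s2] ->] := penalty_max_attained (phi h y).
  rewrite penalty_shift lerD2r.
  have [ys|ys] := leP (F y (s + h)) (- (1 / 2)); first by lra.
  have /andP[? ?] : - L + d < s + h < L - d by apply: inner => //; apply/andP; split; lra.
  by apply: penalty_max_ge; apply/andP; split; lra.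
have [s /andP[s1 s2] sE] := penalty_max_attained y.
have /andP[? ?] : - L + d < s < L - d.
  by apply: inner; [lra|apply/andP; split; lra].
have -> : penalty_max y + h = F (phi h y) (s - h) by rewrite penalty_shift subrK sE.
by apply: penalty_max_ge; apply/andP; split; lra.
Qed.

Lemma bebutov_section : exists2 B, extendable phi B & flow_inner phi B x.
Proof.
have [d d0 /closed_nbhs_exists[U Ux cU]] := penalty_max_shift.
(* Near [x] the flow raises [penalty_max] at unit speed, so a level set is crossed once, after a
   time equal to the missing height. *)
pose B := closure U `&` [set y | penalty_max y = penalty_max x].
have cB : closed B.
  apply: closedI; first exact: closed_closure.
  rewrite (_ : mkset _ = penalty_max @^-1` [set penalty_max x])//.
  by apply: closed_preimage penalty_max_continuous _; exact: closed_eq.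
exists B.
  exists d => //; rewrite -(closure_id _).1// => y t [/cU cy yx] [_ /= tx] td.
  by move: tx; rewrite cy// yx; lra.
split; first by split => //; apply: subset_closure; exact: nbhs_singleton.
move=> e e0.
have [[W T] [/= Wx /nbhs_ballP[r /= r0 rT]] WT] := near_flow phiP Ux.
pose m := Num.min (Num.min e d) (r / 2).
have [me md mr] : [/\ m <= e, m <= d & m <= r / 2] by rewrite /m !ge_min !lexx !orbT.
have m0 : 0 < m by rewrite /m !lt_min e0 d0 divr_gt0.
have /cvgrPdist_le/(_ _ m0) near_max := @penalty_max_continuous x.
apply: filterS (filterI (filterI Wx Ux) near_max) => y [[Wy Uy] ym].
pose h := penalty_max x - penalty_max y.
have hm : `|h| <= m by [].
exists (- h).
  by rewrite /= in_itv /= -ler_norml normrN (le_trans hm).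
exists (phi h y); last by rewrite flowK.
split.
  apply: subset_closure; apply: (WT (y, h)); split => //=; apply: rT.
  by rewrite /ball /= sub0r normrN (le_lt_trans hm)//; lra.
rewrite /= (cU y (subset_closure Uy)) ?(le_trans hm)// /h; lra.
Qed.

End bebutov.

Lemma local_section_exists {R : realType} {X : metricType R} (phi : R -> X -> X) x :
  is_flow phi -> regular_flow phi ->
  exists2 B, extendable phi B & flow_inner phi B x.
Proof.
move=> phiP reg.
have [L L0 [nL nNL]] : exists2 L, 0 < L & phi L x <> x /\ phi (- L) x <> x.
  have [t tx] := reg x.
  have Ntx : phi (- t) x <> x by move=> e; apply: tx; rewrite -[in LHS]e flowNK.
  have [t0|t0|t0] := ltgtP t 0.
  - by exists (- t); rewrite ?oppr_gt0// opprK.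
  - by exists t.
  - by rewrite t0 flow0 in tx.
have dL : 0 < mdist x (phi L x) by rewrite mdist_gt0; apply/eqP => /esym.
have dNL : 0 < mdist x (phi (- L) x) by rewrite mdist_gt0; apply/eqP => /esym.
(* With [M = (L + 2) / m] both products in the hypotheses on [M] are at least [L + 2]. *)
pose m := Num.min (mdist x (phi L x)) (mdist x (phi (- L) x)).
have m0 : 0 < m by rewrite lt_min dL.
have M0 : 0 < (L + 2) / m by rewrite divr_gt0// addr_gt0.
apply: (@bebutov_section _ _ _ phiP x L ((L + 2) / m)) => //.
  apply: (@lt_le_trans _ _ ((L + 2) / m * m)); first by rewrite divfK ?gt_eqF//; lra.
  by rewrite ler_pM2l// /m ge_min lexx.
apply: (@lt_le_trans _ _ ((L + 2) / m * m)); first by rewrite divfK ?gt_eqF//; lra.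
by rewrite ler_pM2l// /m ge_min lexx orbT.
Qed.

(** * Global sections *)

Section global_section.
Context {R : realType} {X : metricType R} (phi : R -> X -> X).
Context (cX : compact [set: X]) (phiP : is_flow phi) (reg : regular_flow phi).
Context (sfb : small_flow_boundary_property phi).
Implicit Types (A B G K S V : set X) (x y p : X) (e : R).

(** Local containment in an extendable [B] survives unions with disjoint closures. Having [p] in the
    flow interior of [B] lets the small flow boundary property be applied at every [p], on [S] or
    not. *)
Definition locally_section S := forall p, exists B,
  [/\ extendable phi B, flow_inner phi B p & \forall y \near p, S y -> B y].

Lemma locally_section0 : locally_section set0.
Proof.
move=> p; have [B eB iB] := local_section_exists p phiP reg.
by exists B; split => //; apply: filterS filterT => y _ [].
Qed.

Lemma locally_section_closure S :
  (forall p, closure S p -> exists B,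
    [/\ extendable phi B, flow_inner phi B p & \forall y \near p, S y -> B y]) ->
  locally_section S.
Proof.
move=> h p; have [/h//|/existsNP[V /not_implyP[Vp nV]]] := pselect (closure S p).
have [B eB iB] := local_section_exists p phiP reg.
exists B; split => //; apply: filterS Vp => y Vy Sy.
by exfalso; apply: nV; exists y.
Qed.

Lemma locally_sectionU S S' : locally_section S -> locally_section S' ->
  closure S `&` closure S' = set0 -> locally_section (S `|` S').
Proof.
have key A A' p : locally_section A -> ~ closure A' p -> exists B,
    [/\ extendable phi B, flow_inner phi B p & \forall y \near p, (A `|` A') y -> B y].
  move=> lA /existsNP[V /not_implyP[Vp nV]]; have [B [eB iB nB]] := lA p.
  exists B; split => //; apply: filterS (filterI Vp nB) => y [Vy hy] [/hy//|A'y].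
  by exfalso; apply: nV; exists y.
move=> lS lS' dis p; have [cp|ncp] := pselect (closure S' p).
  have ncp : ~ closure S p.
    by move=> cp'; have : (closure S `&` closure S') p by []; rewrite dis.
  by rewrite setUC; exact: key.
exact: key.
Qed.

Lemma locally_section_gap S : locally_section S ->
  exists2 a, 0 < a & transverse phi a S.
Proof.
move=> lS; have /compact_near_coveringP cov := cX.
have : \forall a \near (0 : R)^'+, [set: X] `<=`
    (fun y => forall t, S y -> S (phi t y) -> `|t| <= a -> t = 0).
  apply: (cov _ _ (fun a y => forall t, S y -> S (phi t y) -> `|t| <= a -> t = 0)
    (at_right_proper_filter _)) => p _.
  have [B [[e e0 tB] _ nB]] := lS p.
  have [[W T] [/= Wp /nbhs_ballP[d /= d0 dT]] WT] := near_flow phiP nB.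
  have m0 : 0 < Num.min e (d / 2) by rewrite lt_min e0 divr_gt0.
  exists (W, [set a | a <= Num.min e (d / 2)]).
    by split => //=; exact: nbhs_right_le.
  move=> [y a] [/= Wy]; rewrite le_min => /andP[ae ad] t Sy St ta.
  apply: (tB y); last exact: le_trans ae.
    apply: subset_closure; move: (WT (y, 0)); rewrite /= flow0//; apply => //.
    by split => //=; apply: dT; exact: ballxx.
  apply: subset_closure; apply: (WT (y, t)) => //; split => //=; apply: dT.
  rewrite /ball /= sub0r normrN; apply: le_lt_trans ta _; lra.
move=> near_a; have [a [a0 ha]] : exists a, 0 < a /\ [set: X] `<=`
    (fun y => forall t, S y -> S (phi t y) -> `|t| <= a -> t = 0).
  near (0 : R)^'+ => a; exists a; split; first by near: a; exact: nbhs_right_gt.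
  by near: a.
by exists a => // y t; exact: ha.
Unshelve. all: by end_near. Qed.

(** In a local flow box a point shares its periods with the point of the section on its orbit, and
    transversality excludes short ones; compactness makes the bound uniform. *)
Lemma period_bound : exists2 b, 0 < b & forall x t, phi t x = x -> `|t| <= b -> t = 0.
Proof.
have /compact_near_coveringP cov := cX.
have near_b : \forall b \near (0 : R)^'+, [set: X] `<=`
    (fun y => forall t, phi t y = y -> `|t| <= b -> t = 0).
  apply: (cov _ _ (fun b y => forall t, phi t y = y -> `|t| <= b -> t = 0)
    (at_right_proper_filter _)) => p _.
  have [B [e e0 tB] [Bp /(_ e e0) iB]] := local_section_exists p phiP reg.
  exists (flow_image phi `[- e, e] B, [set b | b <= e]).
    by split => //=; exact: nbhs_right_le.
  move=> [y b] [/= [u _ [z Bz <-]] be] t per tb.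
  apply: (tB z); [exact: subset_closure| |exact: le_trans be].
  rewrite (_ : phi t z = z); first exact: subset_closure.
  by rewrite -[RHS](flowK phiP u) -per -!flowD//; congr phi; lra.
have [b [b0 hb]] : exists b, 0 < b /\ [set: X] `<=`
    (fun y => forall t, phi t y = y -> `|t| <= b -> t = 0).
  near (0 : R)^'+ => b; exists b; split; first by near: b; exact: nbhs_right_gt.
  by near: b.
by exists b => // y t; exact: hb.
Unshelve. all: by end_near. Qed.

(** Near [p] the closure of [S] lies in that of [B], which no orbit meets twice within time [m / 2];
    so at least one of the times [m / 2] and [m] is outside. *)
Lemma locally_section_exit S p c : locally_section S -> 0 < c ->
  exists2 s, 0 < s < c & ~ closure S (phi s p).
Proof.
move=> lS c0; have [B [[e e0 tB] _ nB]] := lS p.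
have [[W T] [/= Wp /nbhs_ballP[d /= d0 dT]] WT] := near_flow phiP (nbhs_interior nB).
pose m := Num.min (Num.min e c) d / 2.
have [me mc md] : [/\ m + m <= e, m + m <= c & m + m <= d].
  by rewrite /m -splitr !ge_min !lexx !orbT.
have m0 : 0 < m by rewrite /m divr_gt0// !lt_min e0 c0 d0.
have in_B s : 0 <= s < d -> closure S (phi s p) -> closure B (phi s p).
  move=> /andP[s0 sd] cS.
  have nS : nbhs (phi s p) [set y | S y -> B y].
    apply: (WT (p, s)); split => /=; first exact: nbhs_singleton.
    by apply: dT; rewrite /ball /= sub0r normrN ger0_norm.
  move=> V nV; have [z [Sz [hz Vz]]] := cS _ (filterI nS nV).
  by exists z; split => //; exact: hz.
have [c1|c1] := pselect (closure S (phi (m / 2) p)); last first.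
  by exists (m / 2) => //; apply/andP; split; lra.
exists m; first by apply/andP; split; lra.
move=> c2; have B1 : closure B (phi (m / 2) p) by apply: in_B => //; apply/andP; split; lra.
have B2 : closure B (phi (m / 2) (phi (m / 2) p)).
  by rewrite -flowD// -splitr; apply: in_B => //; apply/andP; split; lra.
have : m / 2 = 0 by apply: (tB _ _ B1 B2); rewrite ger0_norm; lra.
lra.
Qed.

(* [(G, (l, r))]: a small section [G] in [B] all of whose translates by times in
   [(l, r)] avoid [S]. *)
Definition piece S B c (a : set X * (R * R)) :=
  [/\ a.1 `<=` B, forall y, closure a.1 y -> flow_inner phi B y, null_boundary phi a.1,
    0 < a.2.1 /\ a.2.1 < a.2.2 < c &
    forall s y, a.2.1 < s < a.2.2 -> closure a.1 y -> ~ closure S (phi s y)].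

Lemma piece_exists S B c p : locally_section S -> extendable phi B ->
  flow_inner phi B p -> 0 < c ->
  exists2 a, piece S B c a & \forall y \near p, B y -> a.1 y.
Proof.
move=> lS eB iB c0.
have [s /andP[s0 sc] ncS] := locally_section_exit p lS c0.
have : nbhs (phi s p) (~` closure S).
  by apply: open_nbhs_nbhs; split => //; exact/closed_openC/closed_closure.
move=> /(@flow_continuous2 _ _ _ phiP (s, p))[[T W] [/= /nbhs_ballP[d /= d0 dT] Wp] TW].
have [U Up cU] := closed_nbhs_exists (filterI Wp (near_closure_flow_inner cX phiP eB iB)).
have [G [GB GU iG nG]] := null_boundary_exists cX phiP sfb eB iB Up.
pose m := Num.min (Num.min s (c - s)) d / 2.
have [ms mc md] : [/\ m + m <= s, m + m <= c - s & m + m <= d].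
  by rewrite /m -splitr !ge_min !lexx !orbT.
have m0 : 0 < m by rewrite /m divr_gt0// !lt_min s0 subr_gt0 sc d0.
exists (G, (s - m, s + m)); last exact: near_flow_inner GB iG.
split => //=.
- by move=> y cG; case: (cU y (closureS GU cG)) => _; apply; exact: closureS cG.
- split; first by lra.
  by apply/andP; split; lra.
move=> t y /andP[t1 t2] /(closureS GU) /cU[Wy _].
apply: (TW (t, y)); split => //=; apply: dT.
by rewrite /ball /= ltr_norml; apply/andP; split; lra.
Qed.

(** A piece is known to avoid only the initial [S], so [L] records the times already used.
    Translates of [closure B] by distinct times below [e] are disjoint, and the open interval of the
    next piece always contains a time outside the finite list [L]. *)
Lemma add_pieces S B e c (l : seq (set X * (R * R))) :
  transverse phi e (closure B) -> extendable phi B -> c <= e ->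
  locally_section S -> null_boundary phi S ->
  (forall a, List.In a l -> piece S B c a) ->
  exists S' (L : seq R), [/\ S `<=` S', locally_section S', null_boundary phi S',
    forall x, closure S' x -> closure S x \/
      exists2 s, s \in L & 0 < s < c /\ closure B (phi (- s) x) &
    forall a, List.In a l -> exists2 s, 0 < s < c & forall y, a.1 y -> S' (phi s y)].
Proof.
move=> tB eB ce lS nS; elim: l => [|[G [u v]] l IH] lp.
  by exists S, [::]; split => // x; left.
have [|S' [L [SS' lS' nS' cS' hit]]] := IH; first by move=> a al; apply: lp; right.
have [/= GB cG nG [u0 /andP[uv vc]] av] := lp (G, (u, v)) (or_introl erefl).
have [s /andP[us sv] sL] := exists_between_notin L uv.
pose D := phi (- s) @^-1` G.
have cD x : closure D x -> closure G (phi (- s) x) by exact: closure_shift.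
have sc : 0 < s < c by apply/andP; split; lra.
have BD x : closure D x -> closure B (phi (- s) x) by move=> /cD; exact: closureS.
exists (S' `|` D), (s :: L); split.
- by move=> x Sx; left; exact: SS'.
- apply: locally_sectionU => //.
    apply: locally_section_closure => p /cD cp.
    exists (phi (- s) @^-1` B); split.
    + exact: extendable_shift.
    + exact/flow_inner_shift/cG.
    + by apply: filterS filterT => y _; exact: GB.
  apply/seteqP; split => // x [S'x Dx].
  have xE : x = phi s (phi (- s) x) by rewrite flowNK.
  have [Sx|[s' s'L [/andP[s'0 s'c] Bs']]] := cS' x S'x.
    by apply: (av s (phi (- s) x)); [rewrite us sv|exact: cD|rewrite -xE].
  have ss' : s' - s = 0.
    apply: (tB (phi (- s') x)) => //.
      by rewrite addrC flowD// flowNK//; exact: BD.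
    by rewrite ler_norml; apply/andP; split; lra.
  by have e' : s = s' by [lra]; rewrite e' s'L in sL.
- by apply: null_boundaryU => //; exact: null_boundary_shift.
- move=> x; rewrite closureU => -[/cS'[|[s' s'L h]]|cx]; first by left.
    by right; exists s' => //; rewrite inE s'L orbT.
  by right; exists s; [rewrite inE eqxx|split => //; exact: BD].
move=> a /= [<-|al].
  by exists s => // y Gy; right; rewrite /D /= flowK.
by have [s' s'c h] := hit a al; exists s' => // y ay; left; exact: h.
Qed.

Lemma extend_section S B K c : locally_section S -> null_boundary phi S ->
  extendable phi B -> compact K -> (forall p, K p -> flow_inner phi B p) -> 0 < c ->
  exists S', [/\ S `<=` S', locally_section S', null_boundary phi S' &
    forall p, K p -> exists2 t, `|t| <= c & S' (phi t p)].
Proof.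
move=> lS nS eB cK KB c0; have [e e0 tB] := eB.
pose d := Num.min e c.
have [de dc] : d <= e /\ d <= c by rewrite /d !ge_min !lexx orbT.
have d0 : 0 < d by rewrite lt_min e0.
have [p Kp|l lp cover] := compact_list_cover (A := set X * (R * R)) (K := K) (Q := piece S B d)
    (U := fun a => [set y | B y -> a.1 y]) cK.
  by apply: piece_exists => //; exact: KB.
have [S' [L [SS' lS' nS' _ hit]]] := add_pieces tB eB de lS nS lp.
exists S'; split => // p Kp; have [a al ap] := cover p Kp.
have [s /andP[s0 sd] h] := hit a al; exists s.
  by rewrite gtr0_norm// ltW// (lt_le_trans sd).
by apply: h; apply: ap; case: (KB p Kp).
Qed.

(** Finitely many flow boxes over compact parts [a.2] of local sections cover [X]. Half of [c] is
    spent on reaching [a.2] inside a box, the other half on going from there to [S]. *)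
Lemma section_exists c : 0 < c -> exists S, [/\ locally_section S, null_boundary phi S &
  forall x, exists2 t, `|t| <= c & S (phi t x)].
Proof.
move=> c0; have c20 : 0 < c / 2 by rewrite divr_gt0.
pose Q (a : set X * set X) := [/\ extendable phi a.1, compact a.2 &
  forall p, a.2 p -> flow_inner phi a.1 p].
have [x _|l lQ cover] := compact_list_cover (Q := Q)
    (U := fun a => flow_image phi `[- (c / 2), c / 2] a.2) cX.
  have [B eB iB] := local_section_exists x phiP reg.
  have [U Ux cU] := closed_nbhs_exists (near_closure_flow_inner cX phiP eB iB).
  exists (B, closure B `&` closure U) => /=.
    split => //=; last by move=> p [Bp /cU]; apply.
    apply: (subclosed_compact _ cX) => //.
    by apply: closedI; exact: closed_closure.
  have [_ /(_ _ c20)] := flow_inner_local phiP iB Ux.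
  apply: filterS => _ [t tc [y [By Uy] <-]]; exists t => //; exists y => //.
  by split; exact: subset_closure.
have [S [lS nS hit]] : exists S, [/\ locally_section S, null_boundary phi S &
    forall a, List.In a l -> forall p, a.2 p -> exists2 t, `|t| <= c / 2 & S (phi t p)].
  elim: l lQ {cover} => [|a l IH] lQ.
    exists set0; split => //; first exact: locally_section0.
    by rewrite /null_boundary closure0 set0D; exact: orbit_null0.
  have [|S [lS nS hit]] := IH; first by move=> b bl; apply: lQ; right.
  have [eB cK KB] := lQ a (or_introl erefl).
  have [S' [SS' lS' nS' hit']] := extend_section lS nS eB cK KB c20.
  exists S'; split => // b /= [<-//|bl] p bp.
  by have [t tc St] := hit b bl p bp; exists t => //; exact: SS'.
exists S; split => // x; have [a al [u /= uc [y ay yx]]] := cover x I.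
have [t tc St] := hit a al y ay.
move: uc; rewrite in_itv /= -ler_norml => uc.
exists (t - u); first by apply: le_trans (ler_normB _ _) _; lra.
by rewrite flowD// -yx flowK.
Qed.

(** [C] is cut out of [S] by a small [G] with null boundary. Around a flow interior point of [G],
    nearby points of [S] lie in [B] and therefore in [G], so the relative boundary of [C] is
    contained in the flow boundary of [G]. *)
Lemma fine_cover S e : locally_section S -> 0 < e -> exists2 l : seq (set X),
  (forall C, List.In C l -> (forall x y, C x -> C y -> ball x e y) /\
    orbit_null phi (closure C `&` closure (S `\` C))) &
  forall x, S x -> exists2 C, List.In C l & C x.
Proof.
move=> lS e0.
have [p _|l lQ cover] := compact_list_cover
    (Q := fun C => (forall x y, C x -> C y -> ball x e y) /\
      orbit_null phi (closure C `&` closure (S `\` C)))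
    (U := fun C => [set y | S y -> C y]) cX; last first.
  by exists l => // x Sx; have [C Cl h] := cover x I; exists C => //; exact: h.
have [B [eB iB nB]] := lS p.
have e20 : 0 < e / 2 by rewrite divr_gt0.
have [U Up cU] := closed_nbhs_exists (filterI (nbhs_interior nB) (nbhsx_ballx p _ e20)).
have [G [GB GU iG nG]] := null_boundary_exists cX phiP sfb eB iB Up.
exists (S `&` G); last first.
  by apply: filterS (filterI nB (near_flow_inner phiP eB GB iG)) => y [h1 h2] Sy; split; auto.
split.
  move=> x y [_ /GU /subset_closure /cU[_ px]] [_ /GU /subset_closure /cU[_ py]].
  by rewrite (splitr e); exact: ball_triangle (ball_sym px) py.
apply: orbit_nullS nG => x [cx cSx].
have cGx : closure G x by apply: closureS cx => y [].
split => // iGx; have /cU[iBx _] : closure U x by exact: closureS cGx.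
have [z [[Sz nz] [h1 h2]]] :=
  cSx _ (filterI (near_flow_inner phiP eB GB iGx) iBx).
by apply: nz; split => //; apply: h1; apply: h2.
Qed.

Lemma fine_covers S : locally_section S ->
  exists (C : nat * nat -> set X) (N : nat -> nat),
  [/\ forall k x, S x -> exists2 i, (i < N k)%N & C (k, i) x,
    forall k i x y, C (k, i) x -> C (k, i) y -> ball x k.+1%:R^-1 y &
    forall j, orbit_null phi (closure (C j) `&` closure (S `\` C j))].
Proof.
move=> lS; pose P k (l : seq (set X)) := (forall C, List.In C l ->
    (forall x y, C x -> C y -> ball x (k.+1%:R^-1 : R) y) /\
    orbit_null phi (closure C `&` closure (S `\` C))) /\
  forall x, S x -> exists2 C, List.In C l & C x.
have /choice[f fP] : forall k, exists l, P k l.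
  move=> k; have k0 : 0 < k.+1%:R^-1 :> R by rewrite invr_gt0.
  by have [l h1 h2] := fine_cover lS k0; exists l.
have inP k i : (i < size (f k))%N -> List.In (nth set0 (f k) i) (f k).
  elim: (f k) i => [//|C l IH] [|i] /= il; first by left.
  by right; exact: IH.
(* Past the end of the list the default [set0] is harmless: it has no points and an empty relative
   boundary. *)
exists (fun j => nth set0 (f j.1) j.2), (fun k => size (f k)); split.
- move=> k x Sx; have [_ /(_ x Sx)[C Cl Cx]] := fP k.
  have [i il iC] : exists2 i, (i < size (f k))%N & nth set0 (f k) i = C.
    elim: (f k) Cl => [//|C' l IH] /= [->|/IH[i il <-]]; first by exists 0%N.
    by exists i.+1.
  by exists i => //=; rewrite iC.
- move=> k i x y /=; have [il|il] := ltnP i (size (f k)); last by rewrite nth_default.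
  by have [h _] := fP k; case: (h _ (inP k i il)) => h1 _; exact: h1.
move=> [k i] /=; have [il|il] := ltnP i (size (f k)).
  by have [h _] := fP k; case: (h _ (inP k i il)).
by rewrite nth_default// closure0 set0I; exact: orbit_null0.
Qed.

End global_section.

Theorem proposition2p2 (R : realType) (X : metricType R) (phi : R -> X -> X) :
  compact [set: X] -> is_flow phi -> regular_flow phi ->
  small_flow_boundary_property phi ->
  exists (Y : metricType R) (T : Y -> Y) (r : Y -> R)
         (Psi : R -> suspension T r -> suspension T r)
         (pi : suspension T r -> X),
    [/\ compact [set: Y], zero_dimensional Y, homeomorphism T,
        continuous r & forall y, 0 < r y] /\
    [/\ is_suspension_flow Psi, topological_extension Psi phi pi
      & strongly_isomorphic phi pi].
Proof.
move=> cX phiP reg sfb.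
have [b b0 period] := period_bound cX phiP reg.
(* [S] is hit within [b / 3] of the point at time [2 b / 3], hence at a time between [b / 3] and
   [b]; likewise backwards. *)
have c0 : 0 < b / 3 by rewrite divr_gt0.
have [S [lS nS hit]] := section_exists cX phiP reg sfb c0.
have [a a0 gap] := locally_section_gap cX phiP lS.
have [C [N [cover small nC]]] := fine_covers cX phiP sfb lS.
apply: (coded_extension cX phiP a0 gap _ _ period nS cover small nC) => x.
  have [t] := hit (phi (b / 3 + b / 3) x).
  rewrite ler_norml => /andP[t1 t2]; rewrite -flowD// => St.
  by exists (t + (b / 3 + b / 3)) => //; apply/andP; split; lra.
have [t] := hit (phi (- (b / 3 + b / 3)) x).
rewrite ler_norml => /andP[t1 t2]; rewrite -flowD// => St.
exists (b / 3 + b / 3 - t); first by apply/andP; split; lra.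
by rewrite opprB.
Qed.
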